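(* Let $n\ge3$. For $\beta<\frac n2$, consider on the Euclidean motion group $M(n)$ the square integrable and compactly supported function $f_\beta(x,k)=\chi_{B_1(0)}(x)\frac1{|x|^\beta}$. Then for every $1<q<2$ there exists $\beta\in(\frac n3,\frac n2)$ such that $$\int_0^\infty\sum_{\sigma\in\hat M}d_\sigma\|\hat f_\beta(a,\sigma)\|_{S_q}^q\,a^{n-1}\,da=\infty.$$
   Context: $M(n)$ is the semidirect product of $\mathbb R^n$ with $K=SO(n)$, with group law $(x_1,k_1)(x_2,k_2)=(x_1+k_1\cdot x_2,k_1k_2)$ and Haar measure $dx\,dk$ ($dx$, $dk$ Haar measures on $\mathbb R^n$, $K$). $B_1(0)$ is the unit ball of $\mathbb R^n$ centred at $0$ and $\chi$ denotes the indicator function. $M=SO(n-1)$ is the subgroup of $K$ fixing $e_1=(1,0,\dots,0)$, and $\hat M$ is its unitary dual; for $\sigma\in\hat M$, $d_\sigma$ is the dimension of $\sigma$. For $\sigma\in\hat M$, $L^2(K,\mathbb C^{d_\sigma\times d_\sigma})$ denotes here the Hilbert space of $d_\sigma\times d_\sigma$ complex matrix valued functions $\varphi$ on $K$ with $\varphi(uk)=\sigma(u)\varphi(k)$ for $u\in M$, $k\in K$, and $\int_K\mathrm{tr}(\varphi(k)^*\varphi(k))\,dk<\infty$. For $(a,\sigma)\in(0,\infty)\times\hat M$, the unitary representation $\pi_{a,\sigma}$ of $M(n)$ on this space is $$\pi_{a,\sigma}(x,k)(\varphi)(s)=e^{ia\langle s^{-1}\cdot e_1,\,x\rangle}\varphi(sk).$$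 For $f\in L^1(M(n))$ the group Fourier transform is $\hat f(a,\sigma)=\int_{M(n)}f(x,k)\pi_{a,\sigma}(x,k)\,dx\,dk$. $S_q$ is the $q$-Schatten class with $\|T\|_{S_q}^q=\mathrm{tr}(T^*T)^{q/2}$ (taken to be $\infty$ if $T\notin S_q$). *)

(* Defs.v *)
From HB Require Import structures.
From mathcomp Require Import all_boot all_order all_algebra.
From mathcomp Require Import all_classical all_reals all_analysis.
From mathcomp Require Import complex.

Set Implicit Arguments.
Unset Strict Implicit.
Unset Printing Implicit Defensive.

Import Order.TTheory GRing.Theory Num.Theory.
Import numFieldNormedType.Exports.

Local Open Scope classical_set_scope.
Local Open Scope ring_scope.
Local Open Scope complex_scope.
Local Open Scope sesquilinear_scope.
Local Open Scope quotient_scope.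

(* Num.Theory also exports functions named Re and Im, with values in R[i]. *)
Local Notation Re := complex.Re.
Local Notation Im := complex.Im.

Section Euclidean.
Context {R : realType} {n : nat}.
Implicit Types x y : 'cV[R]_n.

Definition dotp x y : R := \sum_i x i 0 * y i 0.

(* The library norm `|x| on matrices is the sup norm. *)
Definition enorm x : R := Num.sqrt (dotp x x).

(* (1, 0, ..., 0), written so as to make sense for every n. *)
Definition e1 : 'cV[R]_n := \col_i (val i == 0%N)%:R.

Definition unit_ball : set 'cV[R]_n := [set x | enorm x < 1].

End Euclidean.

Section SpecialOrthogonal.
Variables (R : realType) (n : nat).

Definition is_SO : pred 'M[R]_n :=
  fun A => (A *m A^T == 1%:M) && (\det A == 1).

Record SO := MkSO { SOval :> 'M[R]_n; _ : is_SO SOval }.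

HB.instance Definition _ := [isSub for SOval].
HB.instance Definition _ := [Choice of SO by <:].

Fact SO_one_proof : is_SO 1%:M.
Proof. by rewrite /is_SO trmx1 mulmx1 det1 !eqxx. Qed.

Fact SO_mul_proof (A B : SO) : is_SO (A *m B).
Proof.
case: A => A /= /andP[/eqP AA /eqP dA]; case: B => B /= /andP[/eqP BB /eqP dB].
rewrite /is_SO det_mulmx dA dB mul1r eqxx andbT trmx_mul.
by rewrite -mulmxA (mulmxA B) BB mul1mx AA.
Qed.

Fact SO_inv_proof (A : SO) : is_SO A^T.
Proof.
case: A => A /= /andP[/eqP AA /eqP dA].
by rewrite /is_SO det_tr dA eqxx andbT trmxK (mulmx1C AA).
Qed.

Definition SO_one := MkSO SO_one_proof.
Definition SO_mul A B := MkSO (SO_mul_proof A B).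
Definition SO_inv A := MkSO (SO_inv_proof A).

Fact SO_mulA : associative SO_mul.
Proof. by move=> A B C; apply: val_inj; rewrite /= mulmxA. Qed.

Fact SO_mul1 : left_id SO_one SO_mul.
Proof. by move=> A; apply: val_inj; rewrite /= mul1mx. Qed.

Fact SO_mulr1 : right_id SO_one SO_mul.
Proof. by move=> A; apply: val_inj; rewrite /= mulmx1. Qed.

Fact SO_mulrV : right_inverse SO_one SO_inv SO_mul.
Proof.
by move=> A; apply: val_inj => /=; case: A => A /= /andP[/eqP].
Qed.

Fact SO_mulV : left_inverse SO_one SO_inv SO_mul.
Proof.
by move=> A; apply: val_inj => /=; apply: mulmx1C; case: A => A /= /andP[/eqP].
Qed.

HB.instance Definition _ :=
  isGroup.Build SO SO_mulA SO_mul1 SO_mulr1 SO_mulV SO_mulrV.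
HB.instance Definition _ := isPointed.Build SO 1%g.
HB.instance Definition _ := Topological.copy SO (initial_topology SOval).

Definition fixes_e1 : pred SO := fun u => (u : 'M[R]_n) *m e1 == e1.

(* The subgroup M = SO(n-1) of K = SO(n). *)
Record SOstab := MkSOstab { SOstabval :> SO; _ : fixes_e1 SOstabval }.

HB.instance Definition _ := [isSub for SOstabval].
HB.instance Definition _ := [Choice of SOstab by <:].

Fact fixes_e1_closed : group_closed fixes_e1.
Proof.
split=> [|u v /eqP uE /eqP vE]; apply/eqP; rewrite /= ?mul1mx//.
rewrite -mulmxA -[X in _ *m (_ *m X)]vE (mulmxA v^T).
have -> : (v : 'M[R]_n)^T *m v = 1%:M.
  by apply: mulmx1C; case: (v) => A /= /andP[/eqP].
by rewrite mul1mx uE.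
Qed.

HB.instance Definition _ :=
  SubChoice_isSubGroup.Build SO fixes_e1 SOstab fixes_e1_closed.
HB.instance Definition _ := Topological.copy SOstab (initial_topology SOstabval).

End SpecialOrthogonal.

Section Motion.
Variables (R : realType) (n : nat).

Definition motion := ('cV[R]_n * SO R n)%type.

HB.instance Definition _ := Choice.on motion.
HB.instance Definition _ := Topological.on motion.

Definition motion_one : motion := (0, 1%g).
Definition motion_mul (g h : motion) : motion :=
  (g.1 + (g.2 : 'M[R]_n) *m h.1, (g.2 * h.2)%g).
Definition motion_inv (g : motion) : motion :=
  (- ((g.2^-1)%g : 'M[R]_n) *m g.1, (g.2^-1)%g).

Fact motion_mulA : associative motion_mul.
Proof.
by move=> f g h; congr pair; rewrite /= ?mulgA// mulmxDr addrA mulmxA.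
Qed.

Fact motion_mul1 : left_id motion_one motion_mul.
Proof. by case=> x k; congr pair; rewrite /= ?mul1g// mul1mx add0r. Qed.

Fact motion_mulr1 : right_id motion_one motion_mul.
Proof. by case=> x k; congr pair; rewrite /= ?mulg1// mulmx0 addr0. Qed.

Fact motion_mulV : left_inverse motion_one motion_inv motion_mul.
Proof. by case=> x k; congr pair; rewrite /= ?mulVg// mulNmx addNr. Qed.

Fact motion_mulrV : right_inverse motion_one motion_inv motion_mul.
Proof.
case=> x k; congr pair; rewrite /= ?mulgV// mulNmx mulmxN mulmxA.
by case: k => A /= /andP[/eqP -> _]; rewrite mul1mx subrr.
Qed.

HB.instance Definition _ :=
  isGroup.Build motion motion_mulA motion_mul1 motion_mulr1 motion_mulV
    motion_mulrV.

End Motion.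

Definition borel (T : ptopologicalType) := g_sigma_algebraType (@open T).

HB.instance Definition _ (T : ptopologicalType) := Measurable.on (borel T).

(* Left Haar measure for the group law op. Regularity is not listed: it is
   automatic on second countable locally compact groups, such as R^n and
   SO(n). *)
Definition is_haar {R : realType} {T : ptopologicalType} (op : T -> T -> T)
    (mu : set (borel T) -> \bar R) : Prop :=
  [/\ forall g (A : set (borel T)), measurable A -> mu (op g @` A) = mu A,
      forall C : set T, compact C -> (mu C < +oo)%E &
      mu setT != 0%E].

Section ComplexIntegral.
Context d (T : measurableType d) (R : realType).

Definition cmeasurable (f : T -> R[i]) : Prop :=
  measurable_fun setT (fun x => Re (f x)) /\
  measurable_fun setT (fun x => Im (f x)).

Definition cintegral (mu : {measure set T -> \bar R}) (f : T -> R[i]) : R[i] :=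
  (\int[mu]_x Re (f x)) +i* (\int[mu]_x Im (f x)).

Definition square_integrable (mu : {measure set T -> \bar R})
    (f : T -> R[i]) : Prop :=
  cmeasurable f /\
  (\int[mu]_x (Re (f x) ^+ 2 + Im (f x) ^+ 2)%:E < +oo)%E.

End ComplexIntegral.

Definition expi {R : realType} (t : R) : R[i] := cos t +i* sin t.

(* A Hilbert space is presented by a set H of vectors of V and a semi-inner
   product ip (linear in its first argument) on H; two elements of H stand for
   the same vector of the Hilbert space when their difference has norm 0, as
   for functions that are equal almost everywhere. *)
Section Hilbert.
Context {R : realType} {V : lmodType R[i]}.
Variables (H : set V) (ip : V -> V -> R[i]).

Definition same_vector (u v : V) : Prop := ip (u - v) (u - v) = 0.

Definition adjoint_of (T S : V -> V) : Prop :=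
  forall u v, H u -> H v -> [/\ H (T u), H (S v) & ip (T u) v = ip u (S v)].

Definition orthonormal_basis (B : set V) : Prop :=
  [/\ B `<=` H,
      forall e, B e -> ip e e = 1,
      forall e e', B e -> B e' -> e <> e' -> ip e e' = 0 &
      forall v, H v -> (forall e, B e -> ip v e = 0) -> same_vector v 0].

(* tr (T^* T)^(q/2): the operator (T^* T)^(q/2) acts by lambda_e^(q/2) on an
   eigenvector e of T^* T with eigenvalue lambda_e, so that its trace is the sum
   of these numbers over an orthonormal basis of eigenvectors; the sum does not
   depend on the basis. A T in S_q is compact, so that such a basis exists;
   without one the infimum is over the empty set and is +oo. *)
Definition schatten_powq (q : R) (T : V -> V) : \bar R :=
  ereal_inf [set s | exists (S : V -> V) (B : set V) (lambda : V -> R),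
    [/\ adjoint_of T S, orthonormal_basis B,
        forall e, B e -> same_vector (S (T e)) ((lambda e)%:C *: e) &
        s = \esum_(e in B) ((lambda e) `^ (q / 2))%:E]].

End Hilbert.

Section UnitaryDual.
Variables (R : realType) (n : nat).
Local Notation M := (SOstab R n).

(* M is compact: its irreducible unitary representations are
   finite-dimensional. *)
Record irrep := Irrep {
  idim : nat;
  irho :> M -> 'M[R[i]]_idim;
  idim_gt0 : (0 < idim)%N;
  irho1 : irho 1%g = 1%:M;
  irhoM : forall u v : M, irho (u * v)%g = irho u *m irho v;
  irho_unitary : forall u, irho u \is unitarymx;
  irho_continuous : forall i j,
    continuous (fun u => Re (irho u i j)) /\
    continuous (fun u => Im (irho u i j));
  irho_irreducible : forall W : {vspace 'cV[R[i]]_idim},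
    (forall u w, w \in W -> irho u *m w \in W) -> W = 0%VS \/ W = fullv
}.

HB.instance Definition _ := gen_eqMixin irrep.
HB.instance Definition _ := gen_choiceMixin irrep.

Definition unitarily_equivalent (s t : irrep) : Prop :=
  exists P : 'M[R[i]]_(idim t, idim s),
    [/\ P *m P^t* = 1%:M, P^t* *m P = 1%:M &
        forall u, P *m s u = t u *m P].

Definition equiv_op (s t : irrep) := `[< unitarily_equivalent s t >].

Fact equiv_refl : reflexive equiv_op.
Proof.
move=> s; apply/asboolP; exists 1%:M.
by split=> [||u]; rewrite ?mul1mx ?mulmx1// trmx1 map_mx1.
Qed.

Let equiv_symW s t : equiv_op s t -> equiv_op t s.
Proof.
move=> /asboolP[P [PP' P'P sPt]]; apply/asboolP; exists (P^t*).
split=> [||u]; rewrite ?trmxCK//.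
rewrite -[LHS]mulmx1 -PP' mulmxA -(mulmxA _ _ P) -sPt.
by rewrite !mulmxA P'P mul1mx.
Qed.

Fact equiv_sym : symmetric equiv_op.
Proof. by move=> s t; apply/idP/idP; apply: equiv_symW. Qed.

Fact equiv_trans : transitive equiv_op.
Proof.
move=> t s r /asboolP[P [PP' P'P sPt]] /asboolP[Q [QQ' Q'Q tQr]].
apply/asboolP; exists (Q *m P); rewrite trmx_mul map_mxM.
split=> [||u].
- by rewrite mulmxA -(mulmxA Q) PP' mulmx1.
- by rewrite mulmxA -(mulmxA _ _ Q) Q'Q mulmx1.
- by rewrite -[LHS]mulmxA sPt mulmxA tQr -mulmxA.
Qed.

Canonical equiv_canonical :=
  EquivRel equiv_op equiv_refl equiv_sym equiv_trans.

Definition unitary_dual : Type := {eq_quot equiv_op}.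
HB.instance Definition _ := Choice.on unitary_dual.
HB.instance Definition _ := EqQuotient.on unitary_dual.

Definition dual_repr (s : unitary_dual) : irrep := repr s.

End UnitaryDual.

Section Fourier.
Context {R : realType} {n : nat}.
Variables (mu : {sigma_finite_measure set (borel 'cV[R]_n) -> \bar R}).
Variables (nu : {sigma_finite_measure set (borel (SO R n)) -> \bar R}).
Implicit Types (s : irrep R n) (a : R).

Definition haar_motion :
    {measure set (borel 'cV[R]_n * borel (SO R n)) -> \bar R} :=
  (mu \x nu)%E.

Definition L2K s : set (SO R n -> 'M[R[i]]_(idim s)) :=
  [set phi : SO R n -> 'M[R[i]]_(idim s) |
    [/\ forall i j, cmeasurable (fun k : borel (SO R n) => phi k i j),
        forall (u : SOstab R n) (k : SO R n),
          phi ((u : SO R n) * k)%g = s u *m phi k &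
        (\int[nu]_k (Re (\tr ((phi k)^t* *m phi k)))%:E < +oo)%E]].

Arguments L2K s _ : clear implicits.

Definition ipK s (phi psi : SO R n -> 'M[R[i]]_(idim s)) : R[i] :=
  cintegral nu (fun k : borel (SO R n) => \tr ((psi k)^t* *m phi k)).

Definition rep_pi a s (g : motion R n) (phi : SO R n -> 'M[R[i]]_(idim s)) :
    SO R n -> 'M[R[i]]_(idim s) :=
  fun k => expi (a * dotp (((k^-1)%g : 'M[R]_n) *m e1) g.1) *: phi (k * g.2)%g.

Fact rep_pi1 a s phi : rep_pi a (s := s) 1%g phi = phi.
Proof.
apply/funext => k; rewrite /rep_pi mulg1 /dotp big1 => [|i _].
  rewrite /expi (mulr0 a) cos0 sin0; exact: scale1r.
by rewrite [X in _ * X]mxE mulr0.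
Qed.

Fact rep_piM a s g h phi :
  rep_pi a (s := s) (g * h)%g phi = rep_pi a g (rep_pi a h phi).
Proof.
apply/funext => k; rewrite /rep_pi /= mulgA scalerA; congr (_ *: _).
have dotpE (x y : 'cV[R]_n) : dotp x y = (x^T *m y) 0 0.
  by rewrite /dotp mxE; apply: eq_bigr => i _; rewrite mxE.
rewrite !dotpE !trmx_mul !trmxK !mulmxDr !mulmxA [X in a * X]mxE mulrDr.
by rewrite /expi cosD sinD; congr Complex; rewrite addrC.
Qed.

(* The operator-valued integral is taken in the weak sense, which determines
   its value up to equality almost everywhere. *)
Definition fourier (f : motion R n -> R[i]) a s :
    (SO R n -> 'M[R[i]]_(idim s)) -> (SO R n -> 'M[R[i]]_(idim s)) :=
  xget (fun=> 0) [set T | forall phi, L2K s phi -> L2K s (T phi) /\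
    forall psi, L2K s psi ->
      ipK (T phi) psi =
      cintegral haar_motion
        (fun g : borel 'cV[R]_n * borel (SO R n) =>
           f g * ipK (rep_pi a g phi) psi)].

Arguments fourier f a s _ : clear implicits.

Definition fourier_schatten (q : R) (f : motion R n -> R[i]) a s : \bar R :=
  schatten_powq (L2K s) (@ipK s) q (fourier f a s).

End Fourier.

Arguments L2K {R n} nu s _.
Arguments ipK {R n} nu {s} phi psi.
Arguments fourier {R n} mu nu f a s _.

Section FBeta.
Context {R : realType} {n : nat}.

(* At x = 0 and beta > 0 the quotient is 0, by the convention on division. *)
Definition f_beta (beta : R) (g : motion R n) : R[i] :=
  (\1_unit_ball g.1 / enorm g.1 `^ beta)%:C.

Definition compactly_supported (f : motion R n -> R[i]) : Prop :=
  compact (closure [set g | f g != 0]).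

End FBeta.

(* Main.v *)
From HB Require Import structures.
Require Import Defs.
From mathcomp Require Import all_boot all_order all_algebra.
From mathcomp Require Import all_classical all_reals all_analysis.
From mathcomp Require Import measurable_realfun.
From mathcomp Require Import complex perm.
From mathcomp Require Import ring lra.

Set Implicit Arguments.
Unset Strict Implicit.
Unset Printing Implicit Defensive.

Import Order.TTheory GRing.Theory Num.Theory.
Import numFieldNormedType.Exports.

Local Open Scope classical_set_scope.
Local Open Scope ring_scope.

(** The summands over the unitary dual are nonnegative, so it suffices that one
    of them has infinite integral, and the class of the trivial representation of
    M does. Write F(a) for the integral of f_beta against the plane wave
    e^(ia<e1,x>). As f_beta depends on |x| only, e1 may be replaced by any unit
    vector, and when s is trivial the Fourier coefficient of f_beta at a is the
    operator that sends phi to the constant function F(a) int_K phi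
    [averaging_spec]. The constants are then eigenvectors of T^* T for the
    eigenvalue (nu(K)|F(a)|)^2 [eigenvalue_of_constants]. An eigenbasis contains a
    vector that is not orthogonal to the constant 1, and such a vector has the
    same eigenvalue, so the q-th power of the Schatten norm is at least
    (nu(K)|F(a)|)^q [schatten_lower_bound]. It remains to make the integral of
    |F(a)|^q a^(n-1) over a > 0 infinite [fhat_radial_diverges]. In polar
    coordinates [polar_integral] this says that the Fourier transform fhat of
    x |-> chi(|x| < 1) |x|^(-beta) on R^n is not in L^q.

    Heuristically fhat(xi) has size |xi|^(beta - n) at infinity, which fails to be
    in L^q once beta >= n (1 - 1/q); since q < 2 this bound is below n/2 and there
    is room for beta. Instead of the asymptotics, a test against balls is used
    [fhat_not_Lq]. Integrate fhat(x - y) over x and y in the ball B_r. By Fubini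
    the result is the integral of f against the squared modulus of the Fourier
    transform of B_r, which is at least a constant times |B_r|^2 on |x| < 1/r; as
    f >= r^beta there on a set of volume comparable to r^(-n), the result is at
    least a constant times r^(n + beta). On the other hand it is at most |B_r|
    times the integral of |fhat| over B_2r, hence at most a constant times
    r^n r^(n (1 - 1/q)) if fhat is in L^q. For r large this contradicts
    beta > n (1 - 1/q).

    The measure on R^n is an arbitrary Haar measure. That balls have volume
    proportional to r^n, and that orthogonal maps preserve the measure, follow
    from one Fubini identity, the usual argument for the uniqueness of Haar
    measure [haar_linear], together with the additivity of the volume of boxes in
    each side [box_cube]. *)

(** * Borel sets of matrix spaces *)

Lemma open_borel (T : ptopologicalType) (U : set T) :
  open U -> measurable (U : set (borel T)).
Proof. exact: sub_sigma_algebra. Qed.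

Lemma closed_borel (T : ptopologicalType) (U : set T) :
  closed U -> measurable (U : set (borel T)).
Proof.
by move=> cU; rewrite -(setCK U); apply: measurableC; apply: open_borel; rewrite openC.
Qed.

Lemma continuous_borel (R : realType) (T : ptopologicalType) (f : T -> R) :
  continuous f -> measurable_fun setT (f : borel T -> R).
Proof.
move=> /continuousP cf; apply: (measurability _ (RGenInftyO.measurableE R)).
move=> _ [_ [a ->] <-]; rewrite setTI; apply: open_borel.
exact/cf/interval_open.
Qed.

Section MatrixBorel.
Context (R : realType) (m n : nat).
Local Notation mat := 'M[R]_(m, n).

Lemma measurable_entry i j :
  measurable_fun setT (fun A : borel mat => A i j).
Proof. by apply: continuous_borel; exact: coord_continuous. Qed.

(** Countably many boxes generate the topology, so the Borel sigma-algebra of the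
    matrix space is generated by the entries. *)
Lemma open_rational_boxes (U : set mat) : open U ->
  U = \bigcup_(p in [set p : {ffun 'I_m * 'I_n -> rat * rat} |
        [set A : mat | forall i j, ratr (p (i, j)).1 < A i j < ratr (p (i, j)).2]
          `<=` U])
      [set A : mat | forall i j, ratr (p (i, j)).1 < A i j < ratr (p (i, j)).2].
Proof.
move=> oU; apply/seteqP; split=> [A UA|A [p pU /pU]//].
have /nbhs_ballP[e /= e0 eU] : nbhs A U by exact: open_nbhs_nbhs.
have lo i j : exists q : rat, A i j - e < ratr q < A i j.
  have [q] := @rat_in_itvoo R (A i j - e) (A i j) ltac:(lra).
  by rewrite in_itv; exists q.
have hi i j : exists q : rat, A i j < ratr q < A i j + e.
  have [q] := @rat_in_itvoo R (A i j) (A i j + e) ltac:(lra).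
  by rewrite in_itv; exists q.
exists [ffun ij => (xchoose (lo ij.1 ij.2), xchoose (hi ij.1 ij.2))].
  move=> B /= BA; apply: eU; split => // i j.
  have := BA i j; rewrite !ffunE/= => /andP[].
  have /andP[? ?] := xchooseP (lo i j).
  have /andP[? ?] := xchooseP (hi i j).
  by move=> ? ?; rewrite /ball/= ltr_distlC; apply/andP; split; lra.
move=> i j; rewrite !ffunE/=.
have /andP[_ ->] := xchooseP (lo i j).
by have /andP[-> _] := xchooseP (hi i j).
Qed.

Lemma measurable_fun_mx d (T : measurableType d) (f : T -> borel mat) :
  (forall i j, measurable_fun setT (fun t => (f t : mat) i j)) ->
  measurable_fun setT f.
Proof.
move=> mf; apply: (@measurability _ _ _ _ setT f (@open mat)) => //.
move=> _ [U oU <-]; rewrite setTI (open_rational_boxes oU) preimage_bigcup bigcup_mkcond.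
apply: countable_bigcupT_measurable => // p.
case: ifPn => _; last exact: measurable0.
rewrite (_ : _ @^-1` _ = \bigcap_(i : 'I_m) \bigcap_(j : 'I_n)
   ((fun t => (f t : mat) i j) @^-1`
      `]ratr (p (i, j)).1, ratr (p (i, j)).2[%classic)); last first.
  apply/seteqP; split=> t /= Ht i => [_ j _|j]; first by rewrite /= in_itv; exact: Ht.
  by have := Ht i I j I; rewrite /= in_itv.
apply: fin_bigcap_measurable => // i _.
apply: fin_bigcap_measurable => // j _.
by rewrite -[X in measurable X]setTI; exact: mf.
Qed.

Lemma continuous_mx (T : topologicalType) (f : T -> mat) :
  (forall i j, continuous (fun t => f t i j)) -> continuous f.
Proof.
move=> cf t A /= [P tP PA].
have : \forall u \near t, forall ij : 'I_m * 'I_n, P ij.1 ij.2 (f u ij.1 ij.2).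
  by apply: filter_forall => -[i j]; exact/cf/tP.
by apply: filterS => u uP; apply: PA => i j; exact: (uP (i, j)).
Qed.

Lemma mx_cube_compact (C : R) :
  compact [set A : mat | forall i j, `|A i j| <= C].
Proof.
have -> : [set A : mat | forall i j, `|A i j| <= C] =
    (@vec_mx R m n) @` [set v : 'rV_(m * n) | forall k, v 0 k \in `[- C, C]].
  apply/seteqP; split=> [A AC|_ [v vC <-] i j].
    exists (mxvec A); last exact: mxvecK.
    move=> k; case/mxvec_indexP: k => i j.
    by rewrite mxvecE in_itv/= -ler_norml.
  by rewrite mxE ler_norml; have := vC (mxvec_index i j); rewrite in_itv.
apply: continuous_compact.
  apply: continuous_subspaceT; apply: continuous_mx => i j.
  rewrite (_ : (fun _ => _) = fun v : 'rV[R]_(m * n) => v 0 (mxvec_index i j)).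
    exact: coord_continuous.
  by apply/funext => v; rewrite mxE.
apply: (@rV_compact R _ (fun=> `[- C, C]%classic)) => _.
exact: segment_compact.
Qed.

End MatrixBorel.

(** * Euclidean norm *)

Section EuclideanNorm.
Context {R : realType} {n : nat}.
Implicit Types x y z : 'cV[R]_n.

Lemma dotpC x y : dotp x y = dotp y x.
Proof. by apply: eq_bigr => i _; rewrite mulrC. Qed.

Lemma dotpDl x y z : dotp (x + y) z = dotp x z + dotp y z.
Proof. by rewrite -big_split; apply: eq_bigr => i _; rewrite mxE mulrDl. Qed.

Lemma dotpDr x y z : dotp x (y + z) = dotp x y + dotp x z.
Proof. by rewrite dotpC dotpDl !(dotpC x). Qed.

Lemma dotpZl a x y : dotp (a *: x) y = a * dotp x y.
Proof. by rewrite mulr_sumr; apply: eq_bigr => i _; rewrite mxE mulrA. Qed.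

Lemma dotpZr a x y : dotp x (a *: y) = a * dotp x y.
Proof. by rewrite dotpC dotpZl dotpC. Qed.

Lemma dotpNl x y : dotp (- x) y = - dotp x y.
Proof. by rewrite -scaleN1r dotpZl mulN1r. Qed.

Lemma dotpNr x y : dotp x (- y) = - dotp x y.
Proof. by rewrite dotpC dotpNl dotpC. Qed.

Lemma dotpE x y : dotp x y = (x^T *m y) 0 0.
Proof. by rewrite mxE; apply: eq_bigr => i _; rewrite mxE. Qed.

Lemma dotp_mulmx (P : 'M[R]_n) x y : dotp (P *m x) y = dotp x (P^T *m y).
Proof. by rewrite !dotpE trmx_mul mulmxA. Qed.

Lemma dotpp_ge0 x : 0 <= dotp x x.
Proof. by apply: sumr_ge0 => i _; rewrite -expr2 sqr_ge0. Qed.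

Lemma dotpp_eq0 x : (dotp x x == 0) = (x == 0).
Proof.
apply/eqP/eqP => [/eqP|->]; last by rewrite /dotp big1// => i _; rewrite mxE mul0r.
rewrite psumr_eq0 => [/allP x0|i _]; last by rewrite -expr2 sqr_ge0.
apply/colP => i; have := x0 i (mem_index_enum i).
by rewrite mulf_eq0 orbb mxE => /eqP.
Qed.

Lemma enorm_ge0 x : 0 <= enorm x.
Proof. exact: sqrtr_ge0. Qed.

Lemma sqr_enorm x : enorm x ^+ 2 = dotp x x.
Proof. by rewrite sqr_sqrtr// dotpp_ge0. Qed.

Lemma enormZ a x : enorm (a *: x) = `|a| * enorm x.
Proof.
by rewrite /enorm dotpZl dotpZr mulrA -expr2 sqrtrM ?sqr_ge0// sqrtr_sqr.
Qed.

Lemma enormN x : enorm (- x) = enorm x.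
Proof. by rewrite -scaleN1r enormZ normrN1 mul1r. Qed.

Lemma ler_abs_dotp x y : `|dotp x y| <= enorm x * enorm y.
Proof.
have [->|y0] := eqVneq y 0.
  by rewrite -(scale0r (0 : 'cV_n)) dotpZr mul0r normr0 mulr_ge0 ?enorm_ge0.
rewrite -(ler_pXn2r (ltn0Sn 1)) ?nnegrE ?mulr_ge0 ?enorm_ge0//.
rewrite real_normK ?num_real// exprMn !sqr_enorm.
have y_gt0 : 0 < dotp y y by rewrite lt_def dotpp_eq0 y0 dotpp_ge0.
have := dotpp_ge0 (dotp y y *: x - dotp x y *: y).
rewrite dotpDl !dotpDr !dotpNl !dotpNr !dotpZl !dotpZr (dotpC y x).
rewrite [X in 0 <= X](_ : _ =
    dotp y y * (dotp x x * dotp y y - dotp x y ^+ 2)).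
  by rewrite pmulr_rge0// subr_ge0.
by ring.
Qed.

Lemma ler_enormD x y : enorm (x + y) <= enorm x + enorm y.
Proof.
rewrite -(ler_pXn2r (ltn0Sn 1)) ?nnegrE ?addr_ge0 ?enorm_ge0//.
rewrite sqr_enorm dotpDl !dotpDr (dotpC y x) sqrrD !sqr_enorm.
have := le_trans (ler_norm _) (ler_abs_dotp x y).
rewrite mulr2n; lra.
Qed.

Lemma ler_enormB x y : enorm (x - y) <= enorm x + enorm y.
Proof. by rewrite -(enormN y) ler_enormD. Qed.

Lemma ler_coord_enorm x i : `|x i 0| <= enorm x.
Proof.
rewrite -(ler_pXn2r (ltn0Sn 1)) ?nnegrE ?enorm_ge0// real_normK ?num_real//.
rewrite sqr_enorm /dotp (bigD1 i)//= -expr2 lerDl.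
by apply: sumr_ge0 => j _; rewrite -expr2 sqr_ge0.
Qed.

Lemma enorm_orthogonal (P : 'M[R]_n) x :
  P^T *m P = 1%:M -> enorm (P *m x) = enorm x.
Proof. by move=> PP; rewrite /enorm dotp_mulmx mulmxA PP mul1mx. Qed.

Lemma measurable_coord i : measurable_fun setT (fun x : borel 'cV[R]_n => x i 0).
Proof. exact: measurable_entry. Qed.

Lemma measurable_dotp d (T : measurableType d) (f g : T -> borel 'cV[R]_n) :
  measurable_fun setT f -> measurable_fun setT g ->
  measurable_fun setT (fun t => dotp (f t) (g t)).
Proof.
move=> mf mg; apply: measurable_sum => i.
by apply: measurable_funM; [apply: (measurableT_comp (measurable_coord i) mf)
  |apply: (measurableT_comp (measurable_coord i) mg)].
Qed.

Lemma measurable_enorm : measurable_fun setT (enorm : borel 'cV[R]_n -> R).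
Proof.
have msqrt : measurable_fun setT (Num.sqrt : R -> R).
  by apply: continuous_measurable_fun; exact: sqrt_continuous.
by apply: (measurableT_comp msqrt); apply: measurable_dotp.
Qed.

Lemma measurable_add d (T : measurableType d) (f g : T -> borel 'cV[R]_n) :
  measurable_fun setT f -> measurable_fun setT g ->
  measurable_fun setT ((fun t => (f t : 'cV[R]_n) + g t) : T -> borel 'cV[R]_n).
Proof.
move=> mf mg; apply: measurable_fun_mx => i j; rewrite ord1.
rewrite (_ : (fun _ => _) = (fun t => (f t : 'cV[R]_n) i 0 + (g t : 'cV_n) i 0)).
  by apply: measurable_funD; [apply: (measurableT_comp (measurable_coord i) mf)
    |apply: (measurableT_comp (measurable_coord i) mg)].
by apply/funext => t; rewrite mxE.
Qed.

Lemma measurable_mulmx d (T : measurableType d) (P : 'M[R]_n)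
    (f : T -> borel 'cV[R]_n) :
  measurable_fun setT f ->
  measurable_fun setT ((fun t => P *m f t) : T -> borel 'cV[R]_n).
Proof.
move=> mf; apply: measurable_fun_mx => i j; rewrite ord1.
rewrite (_ : (fun _ => _) = (fun t => \sum_k P i k * (f t : 'cV[R]_n) k 0)).
  apply: measurable_sum => k; apply: measurable_funM => //.
  exact: (measurableT_comp (measurable_coord k) mf).
by apply/funext => t; rewrite mxE.
Qed.

End EuclideanNorm.

(** Monotonicity replaces continuity in the Cauchy functional equation: f is
    squeezed between its values at multiples of 1/N. *)
Lemma additive_ge0_linear (R : realType) (f : R -> R) :
  (forall s t, 0 <= s -> 0 <= t -> f (s + t) = f s + f t) ->
  (forall s, 0 <= s -> 0 <= f s) ->
  forall t, 0 <= t -> f t = t * f 1.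
Proof.
move=> fD f0 t t0.
have f_mono s u : 0 <= s -> s <= u -> f s <= f u.
  by move=> s0 su; rewrite -(subrKC s u) fD ?subr_ge0// lerDl f0// subr_ge0.
have f00 : f 0 = 0.
  by have := fD 0 0 (lexx _) (lexx _); rewrite addr0 => /esym/eqP;
     rewrite -subr_eq0 addrK => /eqP.
have fM k s : 0 <= s -> f (k%:R * s) = k%:R * f s.
  move=> s0; elim: k => [|k IH]; first by rewrite !mul0r.
  by rewrite -natr1 !mulrDl !mul1r fD ?IH// mulr_ge0.
have f1 : 0 <= f 1 by exact: f0.
apply/eqP; apply: contraT; rewrite -subr_eq0 -normr_gt0 => d0.
have [N _ NH] : exists2 N, (0 < N)%N & f 1 / `|f t - t * f 1| < N%:R.
  exists (Num.truncn (f 1 / `|f t - t * f 1|)).+1 => //; exact: truncnS_gt.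
rewrite ltr_pdivrMr// -[X in X * `|_|]normr_nat -normrM mulrBr mulrA -fM// in NH.
have Nt0 : 0 <= N%:R * t by rewrite mulr_ge0.
have /andP[lo hi] := truncn_itv Nt0; set m := Num.truncn (N%:R * t) in lo hi.
have flo : m%:R * f 1 <= f (N%:R * t).
  by rewrite -fM// mulr1 f_mono.
have fhi : f (N%:R * t) <= m.+1%:R * f 1.
  by rewrite -fM// mulr1 f_mono// ltW.
have l2 : m%:R * f 1 <= N%:R * t * f 1 by rewrite ler_wpM2r.
have h2 : N%:R * t * f 1 <= m.+1%:R * f 1 by rewrite ler_wpM2r// ltW.
move: NH; rewrite ltNge => /negP; case.
rewrite ler_distlC; rewrite -natr1 mulrDl mul1r in fhi h2.
by apply/andP; split; lra.
Qed.

Lemma preimage_measurable d d' (T : measurableType d) (U : measurableType d')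
    (f : T -> U) (A : set U) :
  measurable_fun setT f -> measurable A -> measurable (f @^-1` A).
Proof. by move=> mf mA; rewrite -[X in measurable X]setTI; exact: mf. Qed.

Lemma measurable_indic_comp (R : realType) d d' (T : measurableType d)
    (U : measurableType d') (f : T -> U) (A : set U) :
  measurable_fun setT f -> measurable A ->
  measurable_fun setT (fun t => \1_A (f t) : R).
Proof.
move=> mf mA; apply: measurable_indic; exact: preimage_measurable mf mA.
Qed.

Definition cball {R : realType} {n : nat} (r : R) : set (borel 'cV[R]_n) :=
  [set x : 'cV[R]_n | enorm x < r].

Definition box {R : realType} {n : nat} (t : 'I_n -> R) :
    set (borel 'cV[R]_n) :=
  [set x : 'cV[R]_n | forall i, 0 <= x i 0 < t i].

(** * Haar measure on Euclidean space *)

Section HaarVector.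
Context (R : realType) (n : nat).
Variable mu : {sigma_finite_measure set (borel 'cV[R]_n) -> \bar R}.
Hypothesis mu_haar : is_haar (fun x y : 'cV[R]_n => x + y) mu.
Implicit Types (A B : set (borel 'cV[R]_n)) (P : 'M[R]_n).

Lemma haar_translate (g : 'cV[R]_n) A : measurable A ->
  mu [set y : 'cV[R]_n | A (g + y)] = mu A.
Proof.
move=> mA; have [+ _ _] := mu_haar => /(_ (- g) A mA) <-.
congr (mu _); apply/seteqP; split => [y Ay|_ [y Ay <-]] /=.
  by exists (g + y) => //; rewrite addKr.
by rewrite addNKr.
Qed.

Local Lemma measurable_preimage_mulmx B P :
  measurable B -> measurable (mulmx P @^-1` B : set (borel 'cV[R]_n)).
Proof.
move=> mB; rewrite -[X in measurable X]setTI.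
by apply: (@measurable_mulmx R n _ (borel 'cV[R]_n) P id).
Qed.

(** For x fixed, y |-> x + P y is y |-> P (P^-1 x + y), so translation invariance
    makes the inner integral independent of x. *)
Local Lemma haar_shear A B P : measurable A -> measurable B -> P \in unitmx ->
  (\int[mu]_x \int[mu]_y (\1_A x * \1_B ((x : 'cV[R]_n) + P *m y))%:E =
   mu A * mu (mulmx P @^-1` B))%E.
Proof.
move=> mA mB uP.
have mPB : measurable ((mulmx P @^-1` B) : set (borel 'cV[R]_n)).
  exact: measurable_preimage_mulmx.
transitivity (\int[mu]_x
    ((\1_A x)%:E * mu (mulmx P @^-1` B)))%E; last first.
  rewrite ge0_integralZr//; last by apply/measurable_EFinP.
  by rewrite integral_indic// setIT.
apply: eq_integral => x _.
under eq_integral do rewrite EFinM.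
rewrite ge0_integralZl_EFin//; last first.
  apply/measurable_EFinP; apply: measurable_indic_comp => //.
  by apply: measurable_add => //; apply: measurable_mulmx.
congr (_ * _)%E; rewrite -(haar_translate (invmx P *m x) mPB).
rewrite -[X in mu X]setIT -integral_indic//; last first.
  by apply: (preimage_measurable _ mPB); apply: measurable_add.
apply: eq_integral => y _; congr EFin; rewrite !indicE.
congr ((nat_of_bool _)%:R).
by apply/idP/idP; rewrite !inE /= mulmxDr mulKVmx.
Qed.

(** Integrating 1_A(x) 1_B(x + P y) over x first is the same problem with A and B
    exchanged and - P for P, after the translation x |-> x - P y. This is the
    classical proof that mu and its image under a linear map are proportional. *)
Lemma haar_linear A B P : measurable A -> measurable B -> P \in unitmx ->
  (mu A * mu (mulmx P @^-1` B) =
   mu B * mu (mulmx (- P) @^-1` A))%E.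
Proof.
move=> mA mB uP.
have uNP : - P \in unitmx by rewrite unitmxE -scaleN1r detZ unitrM -unitmxE uP
  unitrX// unitrN1.
rewrite -(haar_shear mA mB uP) -(haar_shear mB mA uNP).
have mAB (A1 B1 : set (borel 'cV[R]_n)) P1 : measurable A1 -> measurable B1 ->
   measurable_fun setT (fun z : borel 'cV[R]_n * borel 'cV[R]_n =>
     (\1_A1 z.1 * \1_B1 ((z.1 : 'cV[R]_n) + P1 *m z.2) : R)%:E).
  move=> mA1 mB1; apply/measurable_EFinP; apply: measurable_funM.
    exact: measurableT_comp.
  apply: (@measurable_indic_comp _ _ _ _ (borel _)) => //.
  by apply: measurable_add => //; exact: measurable_mulmx.
have swap (A1 B1 : set (borel 'cV[R]_n)) P1 : measurable A1 -> measurable B1 ->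
    (\int[mu]_x \int[mu]_y (\1_A1 x * \1_B1 ((x : 'cV[R]_n) + P1 *m y))%:E =
     \int[mu]_y \int[mu]_x (\1_A1 x * \1_B1 ((x : 'cV[R]_n) + P1 *m y))%:E)%E.
  move=> mA1 mB1; exact: (fubini_tonelli _ (mAB A1 B1 P1 mA1 mB1)).
rewrite (swap A B P mA mB) (swap B A (- P) mB mA).
apply: eq_integral => y _ /=.
pose W : set (borel 'cV[R]_n) := A `&` [set x : 'cV[R]_n | B (x + P *m y)].
have mtr (z : 'cV[R]_n) : measurable_fun setT
    ((fun x => x + z) : borel 'cV[R]_n -> borel 'cV[R]_n).
  by apply: measurable_add => //.
have mW : measurable W.
  by apply: measurableI => //; exact: preimage_measurable (mtr _) mB.
transitivity (mu W).
  rewrite -[W]setIT -integral_indic//; apply: eq_integral => x _.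
  by rewrite /W indicI.
rewrite -(haar_translate (- (P *m y)) mW).
rewrite -[X in mu X]setIT -integral_indic//; last first.
  by apply: (preimage_measurable _ mW); apply: measurable_add.
apply: eq_integral => x _; congr EFin; rewrite /W mulrC mulNmx !indicE.
rewrite (addrC x) -natrM mulnb; congr ((nat_of_bool _)%:R).
apply/idP/andP; rewrite !inE /= addrAC addNr add0r.
  by rewrite addrC => -[].
by rewrite addrC => -[].
Qed.

Lemma haar_compact_fin A (C : set 'cV[R]_n) : measurable A -> compact C ->
  A `<=` C -> mu A \is a fin_num.
Proof.
move=> mA cC AC; have [_ /(_ C cC) Cfin _] := mu_haar.
rewrite ge0_fin_numE//; apply: le_lt_trans Cfin; apply: le_measure => //.
  by rewrite inE.
rewrite inE; apply: closed_borel; exact: compact_closed.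
Qed.

Lemma measurable_box (t : 'I_n -> R) : measurable (box t).
Proof.
rewrite (_ : box t = \bigcap_(i : 'I_n)
    ((fun x : borel 'cV[R]_n => (x : 'cV_n) i 0) @^-1` `[0, t i[%classic)).
  apply: fin_bigcap_measurable => // i _.
  by apply: preimage_measurable => //; exact: measurable_coord.
by apply/seteqP; split => [x xt i _|x xt i];
  [have := xt i|have := xt i I]; rewrite /= in_itv.
Qed.

Lemma box_fin (t : 'I_n -> R) : mu (box t) \is a fin_num.
Proof.
apply: (haar_compact_fin (measurable_box t)
  (@mx_cube_compact R n 1 (\sum_i `|t i|))) => x xt i j.
rewrite ord1; have /andP[x0 xi] := xt i.
rewrite ger0_norm// (le_trans (ltW xi))// (bigD1 i)//=.
by rewrite (le_trans (ler_norm _))// lerDl sumr_ge0.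
Qed.

Let upd (t : 'I_n -> R) i (s : R) : 'I_n -> R :=
  fun j => if j == i then s else t j.

(** Cutting at x_i = s gives two boxes, the second one up to a translation. *)
Let box_additive t i s u : 0 <= s -> 0 <= u ->
  mu (box (upd t i (s + u))) = (mu (box (upd t i s)) + mu (box (upd t i u)))%E.
Proof.
move=> s0 u0.
pose g : 'cV[R]_n := \col_j (if j == i then - s else 0).
have gE (x : 'cV[R]_n) j :
    (g + x) j 0 = (if j == i then x j 0 - s else x j 0).
  by rewrite !mxE; case: ifPn => _; rewrite ?add0r// addrC.
rewrite -(haar_translate g (measurable_box (upd t i u))).
rewrite -measureU//; first last.
- apply/seteqP; split => // x [/(_ i) + /(_ i)]; rewrite /upd eqxx gE eqxx.
  by move=> /andP[_ xs] /andP[+ _]; rewrite subr_ge0 leNgt xs.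
- apply: (preimage_measurable _ (measurable_box _)).
  exact: measurable_add.
- exact: measurable_box.
congr (mu _); apply/seteqP; split => [x xt|x [xt|xt] j].
- have := xt i; rewrite /upd eqxx => /andP[xi0 xisu].
  have [xis|sxi] := ltP (x i 0) s; [left|right] => j.
    by have := xt j; rewrite /upd; case: eqP => // -> _; rewrite xi0.
  have := xt j; rewrite gE /upd; case: eqP => // -> _.
  by rewrite subr_ge0 sxi/= ltrBlDl.
- have := xt j; rewrite /upd; case: eqP => // _ /andP[-> /=].
  by move=> /lt_le_trans; apply; rewrite lerDl.
- have := xt j; rewrite gE /upd; case: eqP => // _.
  by rewrite subr_ge0 ltrBlDl => /andP[/(le_trans s0) ->].
Qed.

Let box_linear t i s : 0 <= s ->
  fine (mu (box (upd t i s))) = s * fine (mu (box (upd t i 1))).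
Proof.
move=> s0.
apply: (@additive_ge0_linear _ (fun s => fine (mu (box (upd t i s))))) => //.
  by move=> a b a0 b0; rewrite box_additive// fineD//; exact: box_fin.
by move=> a _; exact: fine_ge0.
Qed.

Lemma box_cube (s : R) : 0 <= s ->
  mu (box (fun=> s)) = ((s ^+ n)%:E * mu (box (fun=> 1%R)))%E.
Proof.
move=> s0.
suff H k : (k <= n)%N -> fine (mu (box (fun i : 'I_n => if (i < k)%N then s else 1)))
    = s ^+ k * fine (mu (box (fun=> 1))).
  rewrite -[LHS]fineK ?box_fin// -[X in (_ * X)%E]fineK ?box_fin//.
  rewrite -EFinM -H//; congr (fine (mu (box _)))%:E.
  by apply/funext => i; rewrite ltn_ord.
elim: k => [_|k IH kn]; first by rewrite expr0 mul1r.
pose i := Ordinal kn.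
rewrite (_ : (fun _ => _) = upd (fun j : 'I_n => if (j < k)%N then s else 1) i s).
  rewrite box_linear// exprS -mulrA -IH ?(ltnW kn)//; congr (_ * fine (mu (box _))).
  by apply/funext => j; rewrite /upd; case: eqP => // ->; rewrite /= ltnn.
apply/funext => j; rewrite /upd ltnS leq_eqVlt -val_eqE/=.
by case: (_ == _).
Qed.

(** Otherwise all cubes are null, and they exhaust the space. *)
Lemma box1_gt0 : (0 < mu (box (fun=> 1%R)))%E.
Proof.
rewrite lt0e measure_ge0 andbT; apply/eqP => b0; have [_ _ /eqP] := mu_haar; apply.
pose g (N : nat) : 'cV[R]_n := const_mx N%:R.
pose D N : set (borel 'cV[R]_n) := [set x : 'cV[R]_n | box (fun=> (2 * N)%:R) (g N + x)].
have mD N : measurable (D N).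
  apply: (preimage_measurable _ (measurable_box (fun=> (2 * N)%:R))).
  exact: measurable_add.
have DT : [set: borel 'cV[R]_n] = \bigcup_N D N.
  apply/seteqP; split => // x _.
  pose N := (Num.truncn (\sum_i `|(x : 'cV[R]_n) i 0|)).+1.
  exists N => // i; rewrite mxE /g mxE.
  have xN : `|(x : 'cV[R]_n) i 0| < N%:R.
    apply: le_lt_trans (truncnS_gt _).
    by rewrite (bigD1 i)//= lerDl sumr_ge0.
  move: xN; rewrite ltr_norml natrM => /andP[? ?].
  by apply/andP; split; lra.
apply/eqP; rewrite -measure_le0 DT.
apply: (le_trans (measure_sigma_subadditive _ _ _ (@subset_refl _ _))) => //.
- by apply: bigcup_measurable => N _.
- rewrite eseries0// => N _ _.
  have := haar_translate (g N) (measurable_box (fun=> (2 * N)%:R)).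
  by rewrite box_cube ?ler0n// b0 mule0.
Qed.

Lemma measurable_cball r : measurable (@cball R n r).
Proof.
rewrite (_ : cball r = enorm @^-1` `]-oo, r[%classic).
  exact: preimage_measurable measurable_enorm _.
by apply/seteqP; split => x; rewrite /cball/= in_itv.
Qed.

Lemma cball_fin r : mu (cball r) \is a fin_num.
Proof.
apply: (haar_compact_fin (measurable_cball r) (@mx_cube_compact R n 1 r)).
by move=> x xr i j; rewrite ord1 (le_trans (ler_coord_enorm x i))// ltW.
Qed.

Lemma cball1_gt0 : (0 < mu (cball 1))%E.
Proof.
pose t : R := n.+1%:R^-1.
have t0 : 0 < t by rewrite invr_gt0.
have tn0 : 0 < t ^+ n by rewrite exprn_gt0.
apply: (@lt_le_trans _ _ (mu (box (fun=> t)))).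
  by rewrite box_cube ?ltW// mule_gt0// box1_gt0.
apply: le_measure; rewrite ?inE; [exact: measurable_box|exact: measurable_cball|].
move=> x xt; rewrite /cball/= -(ltr_pXn2r (ltn0Sn 1)) ?nnegrE ?enorm_ge0//.
rewrite sqr_enorm expr1n.
apply: (@le_lt_trans _ _ (\sum_(i < n) t)); last first.
  by rewrite sumr_const card_ord -mulr_natr /t mulrC ltr_pdivrMr// mul1r ltr_nat.
apply: ler_sum => i _; have /andP[xi0 xit] := xt i.
have t1 : t <= 1 by rewrite invf_le1// ler1n.
by rewrite (le_trans (ler_pM xi0 xi0 (ltW xit) (le_trans (ltW xit) t1)))// mulr1.
Qed.

(** [haar_linear] for a dilation compares the ball with a cube, and for cubes the
    scaling is known. *)
Lemma haar_cball r : 0 < r ->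
  mu (cball r) = ((r ^+ n)%:E * mu (cball 1))%E.
Proof.
move=> r0; have rV0 : 0 < r^-1 by rewrite invr_gt0.
have uP : (r^-1%:M : 'M[R]_n) \in unitmx.
  by rewrite unitmxE det_scalar unitrX// unitfE gt_eqF.
have := haar_linear (measurable_cball 1) (measurable_box (fun=> 1)) uP.
have -> : mulmx r^-1%:M @^-1` box (fun=> 1) = box (fun=> r) :> set 'cV[R]_n.
  apply/seteqP; split => y yr i; have := yr i;
    by rewrite mul_scalar_mx mxE (mulrC r^-1) ltr_pdivrMr// mul1r pmulr_lge0.
have -> : mulmx (- r^-1%:M) @^-1` cball 1 = cball r :> set 'cV[R]_n.
  apply/seteqP; split => y;
    by rewrite /cball/= mulNmx enormN mul_scalar_mx enormZ gtr0_norm// mulrC ltr_pdivrMr// mul1r.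
rewrite box_cube ?(ltW r0)// muleCA => /eqP.
rewrite [X in _ == X]muleC.
rewrite muleA; move=> /eqP.
have := box1_gt0; have := box_fin (fun=> 1).
rewrite -(fineK (box_fin (fun=> 1))) -(fineK (cball_fin r)) -(fineK (cball_fin 1)).
rewrite -!EFinM lte_fin => _ b0 [] /(mulIf (lt0r_neq0 b0)) E.
by congr EFin; rewrite -E.
Qed.

(** [haar_linear] with A the unit ball, which P preserves. *)
Lemma haar_orthogonal P B : P^T *m P = 1%:M -> measurable B ->
  mu (mulmx P @^-1` B) = mu B.
Proof.
move=> PP mB; have uP : P \in unitmx by have [] := mulmx1_unit PP.
have := haar_linear (measurable_cball 1) mB uP.
have -> : mulmx (- P) @^-1` cball 1 = cball 1 :> set 'cV[R]_n.
  by apply/seteqP; split => y; rewrite /cball/= mulNmx enormN enorm_orthogonal.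
rewrite (muleC (mu B)) => E; apply/eqP; rewrite eq_le.
rewrite -(lee_pmul2l (cball_fin 1) cball1_gt0).
by rewrite -(lee_pmul2l (cball_fin 1) cball1_gt0 (mu B)) E lexx.
Qed.

End HaarVector.

(** * Polar coordinates *)

Section Density.
Local Open Scope ereal_scope.
Context d (T : measurableType d) (R : realType).
Variables (m : {measure set T -> \bar R}) (g : T -> R).
Hypotheses (mg : measurable_fun setT g) (g0 : forall x, (0 <= g x)%R).

Let mEg : measurable_fun setT (EFin \o g). Proof. exact/measurable_EFinP. Qed.

Let Eg0 x : 0 <= (g x)%:E. Proof. by rewrite lee_fin. Qed.

(** The measure g m, needed to compare the distribution of the norm with an
    explicit measure on the line. *)
Definition mdens (A : set T) := \int[m]_(x in A) (g x)%:E.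

Let mdens0 : mdens set0 = 0. Proof. exact: integral_set0. Qed.

Let mdens_ge0 A : 0 <= mdens A. Proof. exact: integral_ge0. Qed.

Let mdens_sigma_additive : semi_sigma_additive mdens.
Proof.
move=> F mF tF mUF; rewrite /mdens ge0_integral_bigcup//; last first.
  exact: measurable_funTS.
by apply: is_cvg_ereal_nneg_natsum_cond => k _ _; exact: integral_ge0.
Qed.

HB.instance Definition _ := isMeasure.Build _ _ _ mdens mdens0 mdens_ge0
  mdens_sigma_additive.

Definition density : {measure set T -> \bar R} := mdens.

Import HBNNSimple.

Let integral_mdens_nnsfun (h : {nnsfun T >-> R}) :
  \int[density]_x (h x)%:E = \int[m]_x ((h x)%:E * (g x)%:E).
Proof.
rewrite integralT_nnsfun sintegralE.
transitivity (\int[m]_x (\sum_(y \in range h)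
    (y * \1_(h @^-1` [set y]) x)%:E * (g x)%:E)); last first.
  apply: eq_integral => x _; rewrite [in RHS]fimfunE -fsumEFin//.
  by rewrite ge0_mule_fsuml// => y; exact: nnfun_muleindic_ge0.
rewrite ge0_integral_fsum//; last 2 first.
- move=> y; apply: emeasurable_funM => //; apply/measurable_EFinP.
  exact: measurable_funM.
- by move=> y x _; rewrite mule_ge0 ?nnfun_muleindic_ge0.
apply: eq_fsbigr => y; rewrite inE => -[x _ <-].
under [RHS]eq_integral do rewrite EFinM -muleA.
rewrite ge0_integralZl//; first last.
- by rewrite lee_fin.
- by move=> t _; rewrite mule_ge0// lee_fin.
- by apply: emeasurable_funM => //; apply/measurable_EFinP.
congr (_ * _); rewrite [LHS]integral_mkcond; apply: eq_integral => t _.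
by rewrite epatch_indic muleC.
Qed.

Lemma integral_mdens (f : T -> \bar R) : measurable_fun setT f ->
  (forall x, 0 <= f x) -> \int[density]_x f x = \int[m]_x (f x * (g x)%:E).
Proof.
move=> mf f0; pose h := nnsfun_approx measurableT mf.
have hf x : EFin (h k x) @[k --> \oo] --> f x by exact: cvg_nnsfun_approx.
have hnd x a b : (a <= b)%N -> (h a x <= h b x)%R.
  by move=> ab; exact/lefP/nd_nnsfun_approx.
transitivity (limn (fun k => \int[density]_x (h k x)%:E)).
  rewrite -monotone_convergence//.
  - by apply: eq_integral => x _; apply/esym/cvg_lim => //; exact: hf.
  - by move=> k; apply/measurable_EFinP.
  - by move=> k x _; rewrite lee_fin.
  - by move=> x _ a b ab; rewrite lee_fin hnd.
under eq_fun do rewrite integral_mdens_nnsfun.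
rewrite -monotone_convergence//.
- apply: eq_integral => x _; apply/cvg_lim => //.
  by apply: cvgeZr => //; exact: hf.
- by move=> k; apply: emeasurable_funM => //; apply/measurable_EFinP.
- by move=> k x _; rewrite mule_ge0// lee_fin.
- by move=> x _ a b ab; rewrite lee_wpmul2r// lee_fin hnd.
Qed.

End Density.

Lemma integral_expr (R : realType) (n : nat) (b : R) : 0 < b ->
  (\int[lebesgue_measure]_(x in `]0%R, b[) (n.+1%:R * x ^+ n)%:E =
   (b ^+ n.+1)%:E)%E.
Proof.
move=> b0; have mx A : measurable_fun A (fun x : R => (n.+1%:R * x ^+ n)%:E).
  apply/measurable_EFinP; apply: measurable_funM => //.
rewrite integral_itv_obnd_cbnd// integral_itv_bndo_bndc//.
rewrite (@continuous_FTC2 _ _ (fun x => x ^+ n.+1))//.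
- by rewrite expr0n/= sube0.
- apply: continuous_subspaceT => x; apply: cvgM; first exact: cvg_cst.
  exact: exprn_continuous.
- split.
  + by move=> x _; exact: exprn_derivable.
  + by apply: cvg_at_right_filter; exact: exprn_continuous.
  + by apply: cvg_at_left_filter; exact: exprn_continuous.
- by move=> x _; rewrite derive1E exp_derive /= scaler1.
Qed.

(** Bundled as a measure, which depends on the measurability of f. *)
Definition image_measure d1 d2 (X : measurableType d1) (Y : measurableType d2)
    (R : realType) (m : {measure set X -> \bar R}) (f : X -> Y)
    (mf : measurable_fun setT f) : {measure set Y -> \bar R}.
Proof.
by unshelve refine (pushforward m f : {measure set Y -> \bar R}).
Defined.

Section Polar.
Context (R : realType) (n : nat).
Variable mu : {sigma_finite_measure set (borel 'cV[R]_n.+1) -> \bar R}.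
Hypothesis mu_haar : is_haar (fun x y : 'cV[R]_n.+1 => x + y) mu.

Let c := fine (mu (cball 1)).
Let g (a : R) := if 0 < a then c * (n.+1%:R * a ^+ n) else 0.

Let c_ge0 : 0 <= c. Proof. exact: fine_ge0. Qed.

Let g_ge0 a : 0 <= g a.
Proof. by rewrite /g; case: ifPn => // a0; rewrite !mulr_ge0// exprn_ge0// ltW. Qed.

Let measurable_g : measurable_fun setT g.
Proof.
apply: measurable_fun_ifT => //.
  exact: measurable_fun_ltr.
by apply: measurable_funM => //; apply: measurable_funM.
Qed.

Let m2 : {measure set (measurableTypeR R) -> \bar R} :=
  density lebesgue_measure measurable_g g_ge0.

Let m1 : {measure set (measurableTypeR R) -> \bar R} :=
  @image_measure _ _ _ (measurableTypeR R) _ mu enorm measurable_enorm.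

(** Rays are stable under intersection and generate, so it suffices to compare the
    volumes of balls. *)
Let pushforward_enorm (A : set (measurableTypeR R)) : measurable A ->
  m1 A = m2 A.
Proof.
pose G := [set A : set (measurableTypeR R) | exists x, A = `]-oo, x[%classic].
have mG : @measurable _ (measurableTypeR R) = <<s G >> by exact: RGenInftyO.measurableE.
have rayE (b : R) : enorm @^-1` `]-oo, b[%classic = @cball R n.+1 b.
  by apply/seteqP; split => x; rewrite /cball/= in_itv.
apply: (measure_unique G (fun k => `]-oo, (k%:R : R)[%classic)) => //.
- move=> _ _ [a ->] [b ->]; exists (Num.min a b).
  apply/seteqP; split => x; rewrite /= !in_itv/= lt_min; first by case=> -> ->.
  by case/andP.
- by move=> k; exists k%:R.
- apply/seteqP; split => // x _; exists (Num.truncn `|x|).+1 => //=.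
  by rewrite in_itv/= (le_lt_trans (ler_norm _))// truncnS_gt.
- move=> _ [b ->]; rewrite /= /pushforward rayE.
  rewrite /m2 /density /= /mdens.
  have [b0|b0] := ltP 0 b; last first.
    rewrite (_ : cball b = set0) ?measure0; last first.
      by apply/seteqP; split => // x; rewrite /cball/= ltNge (le_trans b0)// enorm_ge0.
    rewrite integral0_eq// => x; rewrite /= in_itv/= => xb.
    by rewrite /g ltNge (le_trans (ltW xb) b0).
  rewrite (haar_cball mu_haar b0) -integral_expr//.
  rewrite -(fineK (cball_fin mu_haar 1)) -/c muleC.
  rewrite -ge0_integralZl//; first last.
  + by move=> x; rewrite /= in_itv/= lee_fin => /andP[x0 _]; rewrite mulr_ge0// exprn_ge0// ltW.
  + by apply/measurable_EFinP; apply: measurable_funM.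
  rewrite [LHS]integral_mkcond [RHS]integral_mkcond; apply: eq_integral => x _.
  rewrite /patch !mem_setE !in_itv/= /g.
  by case: (ltP 0 x) => x0; case: (ltP x b).
- move=> k; rewrite /= /pushforward rayE -ge0_fin_numE//; exact: cball_fin.
Qed.

(** Both sides integrate Phi against measures for which the ray ]-oo, b[ has the
    mass mu (cball b). *)
Lemma polar_integral (Phi : R -> \bar R) : measurable_fun setT Phi ->
  (forall a, 0 <= Phi a)%E ->
  (\int[mu]_x Phi (enorm x) =
   \int[lebesgue_measure]_(a in `]0%R, +oo[)
     (Phi a * (c * (n.+1%:R * a ^+ n))%:E))%E.
Proof.
move=> mPhi Phi0.
transitivity (\int[m2]_a Phi a)%E.
  transitivity (\int[m1]_a Phi a)%E.
    exact/esym/(@ge0_integral_pushforward _ _ _ (measurableTypeR R) _ _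
      measurable_enorm mu setT Phi measurableT mPhi).
  by apply: eq_measure_integral => A mA _; exact: pushforward_enorm.
rewrite integral_mdens// [RHS]integral_mkcond; apply: eq_integral => a _.
rewrite /patch mem_setE in_itv/= andbT /g.
by case: ifPn => // _; rewrite mule0.
Qed.

End Polar.

(** * Real-valued integrals on products *)

Section RealFubini.
Context d1 d2 (T1 : measurableType d1) (T2 : measurableType d2) (R : realType).
Variable m1 : {sigma_finite_measure set T1 -> \bar R}.
Variable m2 : {sigma_finite_measure set T2 -> \bar R}.
Variable F : T1 * T2 -> R.
Hypothesis iF : (m1 \x m2)%E.-integrable setT (EFin \o F).

Lemma Rintegral12 :
  \int[(m1 \x m2)%E]_z F z = \int[m1]_x \int[m2]_y F (x, y).
Proof.
rewrite /Rintegral -(integral12_prod_meas1 iF); congr fine.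
have mF := measurable_fubini_F iF.
apply: ae_eq_integral => //.
  by apply/measurable_EFinP; apply: (measurableT_comp _ mF); exact: fine_measurable.
have := ae_integrable1 iF.
by apply: filterS => x /= Fx _; rewrite fineK//; exact: integrable_fin_num.
Qed.

Lemma Rintegral21 :
  \int[(m1 \x m2)%E]_z F z = \int[m2]_y \int[m1]_x F (x, y).
Proof.
rewrite /Rintegral -(integral21_prod_meas1 iF); congr fine.
have mG := measurable_fubini_G iF.
apply: ae_eq_integral => //.
  by apply/measurable_EFinP; apply: (measurableT_comp _ mG); exact: fine_measurable.
have := ae_integrable2 iF.
by apply: filterS => x /= Fx _; rewrite fineK//; exact: integrable_fin_num.
Qed.

Lemma RFubini : \int[m1]_x \int[m2]_y F (x, y) = \int[m2]_y \int[m1]_x F (x, y).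
Proof. by rewrite -Rintegral12 Rintegral21. Qed.

End RealFubini.

Section RealIntegral.
Context d (T : measurableType d) (R : realType).
Variable m : {measure set T -> \bar R}.
Implicit Types f g h : T -> R.

(** Real-valued integrals are 0 when they diverge, so scaling needs no
    integrability. *)
Lemma RintegralZ f r : measurable_fun setT f ->
  \int[m]_x (r * f x) = r * \int[m]_x f x.
Proof.
have nonint h : measurable_fun setT h -> ~ m.-integrable setT (EFin \o h) ->
    \int[m]_x h x = 0.
  move=> mh nh; have [fin|] := boolP (\int[m]_x (h x)%:E \is a fin_num)%E.
    case: nh; apply/integrableP; split; first exact/measurable_EFinP.
    by move: fin; rewrite integral_fin_num_abs//; exact/measurable_EFinP.
  by rewrite /Rintegral; case: (integral _ _ _).
move=> mf; have [->|r0] := eqVneq r 0.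
  by rewrite mul0r; under eq_Rintegral do rewrite mul0r; rewrite Rintegral_cst ?mul0r.
have [fi|nf] := pselect (m.-integrable setT (EFin \o f)); first exact: RintegralZl.
rewrite (nonint f)// mulr0 nonint//; first exact: measurable_funM.
move=> /(integrableZl measurableT r^-1) rf; apply: nf.
by apply: eq_integrable rf => // x _; rewrite /= -EFinM mulKf.
Qed.

Lemma integrable_le f g : measurable_fun setT f ->
  (forall x, `|f x| <= g x) -> m.-integrable setT (EFin \o g) ->
  m.-integrable setT (EFin \o f).
Proof.
move=> mf fg; apply: le_integrable => //; first exact/measurable_EFinP.
by move=> x _; rewrite lee_fin (le_trans (fg x))// ler_norm.
Qed.

Lemma ge0_integrable f : measurable_fun setT f -> (forall x, 0 <= f x) ->
  (\int[m]_x (f x)%:E < +oo)%E -> m.-integrable setT (EFin \o f).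
Proof.
move=> mf f0 foo; apply/integrableP; split; first exact/measurable_EFinP.
by under eq_integral do rewrite gee0_abs ?lee_fin//.
Qed.

Lemma integrable_indic_fin (A : set T) : measurable A -> m A \is a fin_num ->
  m.-integrable setT (EFin \o (\1_A : T -> R)).
Proof.
move=> mA Afin; apply: ge0_integrable => //.
by rewrite integral_indic// setIT -ge0_fin_numE.
Qed.

Lemma integrableZR r f : m.-integrable setT (EFin \o f) ->
  m.-integrable setT (EFin \o (fun x => r * f x)).
Proof. by move=> fi; apply: eq_integrable (integrableZl measurableT r fi). Qed.

Lemma integrableDR f g : m.-integrable setT (EFin \o f) ->
  m.-integrable setT (EFin \o g) ->
  m.-integrable setT (EFin \o (fun x => f x + g x)).
Proof. by move=> fi gi; apply: eq_integrable (integrableD measurableT fi gi). Qed.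

Lemma integrable_measurable f : m.-integrable setT (EFin \o f) ->
  measurable_fun setT f.
Proof. by move=> /measurable_int/measurable_EFinP. Qed.

End RealIntegral.

Section MeasurePreserving.
Context d (T : measurableType d) (R : realType).
Variables (m : {measure set T -> \bar R}) (g : T -> T).
Hypothesis mg : measurable_fun setT g.
Hypothesis gm : forall A, measurable A -> m (g @^-1` A) = m A.

Lemma integral_preserving (f : T -> \bar R) : measurable_fun setT f ->
  (forall x, 0 <= f x)%E -> (\int[m]_x f (g x) = \int[m]_x f x)%E.
Proof.
move=> mf f0; transitivity (\int[image_measure m mg]_x f x)%E.
  exact/esym/(@ge0_integral_pushforward _ _ _ _ _ _ mg m setT f measurableT mf).
by apply: eq_measure_integral => A mA _; exact: gm.
Qed.

Lemma integrable_preserving (f : T -> R) :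
  m.-integrable setT (EFin \o f) -> m.-integrable setT (EFin \o (f \o g)).
Proof.
move=> /integrableP[mf foo]; apply/integrableP; split.
  exact: (measurableT_comp mf mg).
rewrite (integral_preserving (f := fun x => `|(f x)%:E|%E))//.
exact: measurableT_comp.
Qed.

Lemma Rintegral_preserving (f : T -> R) : measurable_fun setT f ->
  \int[m]_x f (g x) = \int[m]_x f x.
Proof.
move=> mf; rewrite /Rintegral; congr fine.
have mEf : measurable_fun setT (EFin \o f) by exact/measurable_EFinP.
rewrite integralE [RHS]integralE; congr (_ - _)%E.
  have /= <- := integral_preserving (measurable_funepos mEf)
    (funepos_ge0 (EFin \o f)).
  by apply: eq_integral => k _; rewrite !funeposE.
have /= <- := integral_preserving (measurable_funeneg mEf)
  (funeneg_ge0 (EFin \o f)).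
by apply: eq_integral => k _; rewrite !funenegE.
Qed.

End MeasurePreserving.

(** Products sheared by measure-preserving maps A x of the second factor; the
    reflections y |-> x - y and the translations l |-> k l occur below. *)
Section SkewProduct.
Context d1 d2 (T1 : measurableType d1) (T2 : measurableType d2) (R : realType).
Variable m1 : {sigma_finite_measure set T1 -> \bar R}.
Variable m2 : {sigma_finite_measure set T2 -> \bar R}.

Lemma integrable_Rsection (F : T1 * T2 -> R) :
  (m1 \x m2)%E.-integrable setT (EFin \o F) ->
  m1.-integrable setT (EFin \o (fun x => \int[m2]_y F (x, y))).
Proof.
move=> iF; have iG := integrable_fubini_F iF.
apply: le_integrable iG => //.
  apply/measurable_EFinP; apply: (measurableT_comp _ (measurable_fubini_F iF)).
  exact: fine_measurable.
move=> x _; rewrite /= /Rintegral -[X in (_ <= `|X|)%E]/(\int[m2]_y (F (x, y))%:E)%E.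
by case: (\int[m2]_y (F (x, y))%:E)%E => //=; rewrite normr0 leey.
Qed.

Variable A : T1 -> T2 -> T2.
Hypothesis mA : measurable_fun setT (fun z => A z.1 z.2).
Hypothesis A_preserves :
  forall x B, measurable B -> m2 (A x @^-1` B) = m2 B.

Let measurable_A x : measurable_fun setT (A x).
Proof. exact: (measurableT_comp mA (pair1_measurable x)). Qed.

Variables (u : T1 -> R) (v : T2 -> R).
Hypotheses (iu : m1.-integrable setT (EFin \o u))
  (iv : m2.-integrable setT (EFin \o v)).

Let mu_ := integrable_measurable iu.
Let mv := integrable_measurable iv.

Lemma integrable_skew :
  (m1 \x m2)%E.-integrable setT (EFin \o (fun z => u z.1 * v (A z.1 z.2))).
Proof.
apply/integrable12ltyP.
  apply/measurable_EFinP; apply: measurable_funM.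
    exact: measurableT_comp.
  exact: (measurableT_comp mv mA).
have [_ uoo] := integrableP _ _ _ iu; have [_ voo] := integrableP _ _ _ iv.
rewrite (eq_integral (fun x => `|(u x)%:E| * \int[m2]_y `|(v y)%:E|)%E).
  rewrite ge0_integralZr//; last exact: integral_ge0.
    by rewrite lte_mul_pinfty ?integral_ge0// ge0_fin_numE ?integral_ge0.
  by apply: measurableT_comp => //; exact/measurable_EFinP.
move=> x _.
transitivity (\int[m2]_y (`|(u x)%:E| * `|(v (A x y))%:E|))%E.
  by apply: eq_integral => y _; rewrite /= normrM EFinM.
rewrite ge0_integralZl//; last first.
  apply: measurableT_comp => //; apply/measurable_EFinP.
  exact: (measurableT_comp mv (measurable_A x)).
congr (_ * _)%E.
apply: (integral_preserving (measurable_A x) (A_preserves x)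
  (f := fun y => `|(v y)%:E|%E)) => //.
by apply: measurableT_comp => //; exact/measurable_EFinP.
Qed.

Lemma Rintegral_skew :
  \int[(m1 \x m2)%E]_z (u z.1 * v (A z.1 z.2)) = \int[m1]_x u x * \int[m2]_y v y.
Proof.
rewrite Rintegral12; last exact: integrable_skew.
rewrite -RintegralZr//; apply: eq_Rintegral => x _ /=.
rewrite (RintegralZ _ (f := fun y => v (A x y))); last first.
  exact: (measurableT_comp mv (measurable_A x)).
by rewrite (Rintegral_preserving (measurable_A x) (A_preserves x)).
Qed.

End SkewProduct.

Section Product.
Context d1 d2 (T1 : measurableType d1) (T2 : measurableType d2) (R : realType).
Variable m1 : {sigma_finite_measure set T1 -> \bar R}.
Variable m2 : {sigma_finite_measure set T2 -> \bar R}.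

Let sigma_finite_prod : sigma_finite setT (m1 \x m2)%E.
Proof.
have /sigma_finiteP[F [FT ndF Foo]] := sigma_finiteT m1.
have /sigma_finiteP[G [GT ndG Goo]] := sigma_finiteT m2.
exists (fun k => F k `*` G k) => [|k].
  apply/seteqP; split => // -[x y] _.
  have [i _ Fi] : (\bigcup_k F k) x by rewrite -FT.
  have [j _ Gj] : (\bigcup_k G k) y by rewrite -GT.
  exists (maxn i j) => //; split => /=.
    by move: Fi; apply/subsetPset/ndF; rewrite leq_maxl.
  by move: Gj; apply/subsetPset/ndG; rewrite leq_maxr.
have [mF Ffin] := Foo k; have [mG Gfin] := Goo k.
split; first exact: measurableX.
by rewrite product_measure1E// lte_mul_pinfty// ge0_fin_numE.
Qed.

(** The product measure, bundled as a sigma-finite measure so that products can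
    be iterated. *)
Definition sigma_finite_product :
    {sigma_finite_measure set (T1 * T2)%type -> \bar R} :=
  HB.pack (m1 \x m2)%E (Measure_isSigmaFinite.Build _ _ _ _ sigma_finite_prod).

Variables (u : T1 -> R) (v : T2 -> R).
Hypotheses (iu : m1.-integrable setT (EFin \o u))
  (iv : m2.-integrable setT (EFin \o v)).

Lemma integrable_prod :
  (m1 \x m2)%E.-integrable setT (EFin \o (fun z => u z.1 * v z.2)).
Proof.
exact: (integrable_skew (A := fun _ y => y) measurable_snd (fun _ _ _ => erefl)
  iu iv).
Qed.

Lemma Rintegral_prod :
  \int[(m1 \x m2)%E]_z (u z.1 * v z.2) = \int[m1]_x u x * \int[m2]_y v y.
Proof.
exact: (Rintegral_skew (A := fun _ y => y) measurable_snd (fun _ _ _ => erefl)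
  iu iv).
Qed.

End Product.

(** * Topology and Haar measure of the rotation group *)

Section SpecialOrthogonalHaar.
Context (R : realType) (n : nat).
Local Notation K := (SO R n).

Lemma SO_trmx_mul (k : K) : (k : 'M[R]_n)^T *m k = 1%:M.
Proof. by apply: mulmx1C; case: k => A /= /andP[/eqP]. Qed.

Lemma SO_entry_continuous i j : continuous (fun k : K => (k : 'M[R]_n) i j).
Proof.
move=> k; apply: (@continuous_comp _ _ _ (@SOval R n) (fun A : 'M[R]_n => A i j)).
  exact: initial_continuous.
exact: coord_continuous.
Qed.

Lemma measurable_SO_entry i j :
  measurable_fun setT (fun k : borel K => (k : 'M[R]_n) i j).
Proof. by apply: continuous_borel; exact: SO_entry_continuous. Qed.

(** The topology of SO(n) is induced from the matrices. *)
Lemma measurable_fun_SO d (T : measurableType d) (f : T -> borel K) :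
  (forall i j, measurable_fun setT (fun t => (f t : 'M[R]_n) i j)) ->
  measurable_fun setT f.
Proof.
move=> mf; apply: (@measurability _ _ _ _ setT f (@open K)) => //.
move=> _ [_ [U oU <-] <-]; rewrite setTI.
have mg : measurable_fun setT ((fun t => f t : 'M[R]_n) : T -> borel 'M[R]_n).
  exact: measurable_fun_mx.
exact: (preimage_measurable mg (open_borel oU)).
Qed.

Lemma measurable_SO_mul d (T : measurableType d) (f g : T -> borel K) :
  measurable_fun setT f -> measurable_fun setT g ->
  measurable_fun setT ((fun t => (f t * g t)%g) : T -> borel K).
Proof.
move=> mf mg; apply: measurable_fun_SO => i j.
rewrite (_ : (fun _ => _) =
    (fun t => \sum_k (f t : 'M[R]_n) i k * (g t : 'M[R]_n) k j)).
  apply: measurable_sum => k; apply: measurable_funM.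
    exact: (measurableT_comp (measurable_SO_entry i k) mf).
  exact: (measurableT_comp (measurable_SO_entry k j) mg).
by apply/funext => t; rewrite [LHS]mxE.
Qed.

Lemma SO_entry_le1 (k : K) i j : `|(k : 'M[R]_n) i j| <= 1.
Proof.
have /matrixP/(_ j j) := SO_trmx_mul k; rewrite !mxE eqxx mulr1n (bigD1 i)//=.
rewrite mxE -expr2 => E.
have s0 : 0 <= \sum_(l < n | l != i) (k : 'M[R]_n)^T j l * (k : 'M[R]_n) l j.
  by apply: sumr_ge0 => l _; rewrite mxE -expr2 sqr_ge0.
rewrite -(ler_pXn2r (ltn0Sn 1)) ?nnegrE// real_normK ?num_real// expr1n -E.
by rewrite lerDl.
Qed.

Lemma continuous_sum (T : topologicalType) (I : Type) (r : seq I)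
    (F : I -> T -> R) :
  (forall i, continuous (F i)) -> continuous (fun t => \sum_(i <- r) F i t).
Proof.
move=> cF; elim: r => [|i r IH] t.
  rewrite (_ : (fun _ => _) = fun=> 0); first exact: cvg_cst.
  by apply/funext => u; rewrite big_nil.
rewrite (_ : (fun _ => _) = fun u => F i u + \sum_(j <- r) F j u).
  by apply: cvgD; [exact: cF|exact: IH].
by apply/funext => u; rewrite big_cons.
Qed.

Lemma continuous_prod (T : topologicalType) (I : Type) (r : seq I)
    (F : I -> T -> R) :
  (forall i, continuous (F i)) -> continuous (fun t => \prod_(i <- r) F i t).
Proof.
move=> cF; elim: r => [|i r IH] t.
  rewrite (_ : (fun _ => _) = fun=> 1); first exact: cvg_cst.
  by apply/funext => u; rewrite big_nil.
rewrite (_ : (fun _ => _) = fun u => F i u * \prod_(j <- r) F j u).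
  by apply: cvgM; [exact: cF|exact: IH].
by apply/funext => u; rewrite big_cons.
Qed.

Lemma closed_is_SO : closed [set A : 'M[R]_n | is_SO A].
Proof.
have -> : [set A : 'M[R]_n | is_SO A] =
    \bigcap_(i : 'I_n) \bigcap_(j : 'I_n)
      ((fun A : 'M[R]_n => (A *m A^T) i j) @^-1` [set (i == j)%:R])
    `&` ((fun A : 'M[R]_n => \det A) @^-1` [set 1]).
  apply/seteqP; split => [A /andP[/eqP AA /eqP dA]|A [AA dA]].
    by split => // i _ j _; rewrite /= AA mxE.
  apply/andP; split; apply/eqP => //; apply/matrixP => i j.
  by rewrite (AA i I j I) mxE.
apply: closedI.
  apply: closed_bigI => i _; apply: closed_bigI => j _.
  apply: closed_comp; last exact: closed_eq.
  move=> A _; rewrite (_ : (fun _ => _) = fun B : 'M[R]_n => \sum_k B i k * B j k).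
    apply: continuous_sum => k B.
    exact: (cvgM (@coord_continuous R n n i k B) (@coord_continuous R n n j k B)).
  by apply/funext => B; rewrite mxE; apply: eq_bigr => k _; rewrite mxE.
apply: closed_comp; last exact: closed_eq.
move=> A _; rewrite /determinant; apply: continuous_sum => s B.
have cp : continuous (fun t : 'M[R]_n => \prod_i t i (s i)).
  by apply: continuous_prod => i; exact: (@coord_continuous R n n).
exact: (cvgM (cvg_cst _) (cp B)).
Qed.

Lemma SO_compact : compact [set: K].
Proof.
have cS : compact [set A : 'M[R]_n | is_SO A].
  apply: (subclosed_compact closed_is_SO (@mx_cube_compact R n n 1)).
  by move=> A SA i j; exact: (SO_entry_le1 (MkSO SA)).
(* The topology of K is the initial one, so a cluster point of the image of a
   filter that lies in the image of K is a cluster point of the filter. *)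
move=> F PF _.
pose G := @SOval R n @ F.
have PG : ProperFilter G by exact: fmap_proper_filter.
have GS : G [set A : 'M[R]_n | is_SO A].
  by apply: (@filterS _ F _ setT); [case|exact: filterT].
have [A [SA clA]] := cS G PG GS.
exists (MkSO SA); split => // P Q FP; rewrite nbhsE => -[B [[U oU UB] BA] BQ].
have GP : G (@SOval R n @` P).
  by apply: (@filterS _ F _ P) => // k Pk; exists k.
have AU : nbhs A U by apply: open_nbhs_nbhs; split => //; move: BA; rewrite -UB.
have [_ [[k Pk <-] Uk]] := clA _ _ GP AU.
by exists k; split => //; apply: BQ; rewrite -UB.
Qed.

Variable nu : {sigma_finite_measure set (borel K) -> \bar R}.
Hypothesis nu_haar : is_haar (fun k l : K => (k * l)%g) nu.

Lemma haar_SO_translate (g : K) (A : set (borel K)) : measurable A ->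
  nu [set k : K | A (g * k)%g] = nu A.
Proof.
move=> mA; have [+ _ _] := nu_haar => /(_ (g^-1)%g A mA) <-.
congr (nu _); apply/seteqP; split => [y Ay|_ [y Ay <-]] /=.
  by exists (g * y)%g => //; rewrite mulKg.
by rewrite mulVKg.
Qed.

Lemma haar_SO_fin : nu setT \is a fin_num.
Proof.
have [_ fin _] := nu_haar; rewrite ge0_fin_numE//.
exact: fin SO_compact.
Qed.

Lemma haar_SO_gt0 : 0 < fine (nu setT).
Proof.
have [_ _ n0] := nu_haar; rewrite fine_gt0// lt0e n0 measure_ge0/=.
by rewrite -ge0_fin_numE// haar_SO_fin.
Qed.

Lemma haar_SO_integrable_cst (r : R) : nu.-integrable setT (EFin \o (fun=> r)).
Proof.
apply: measurable_bounded_integrable => //.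
  by rewrite -ge0_fin_numE// haar_SO_fin.
by exists `|r|; split; [exact: num_real|move=> M rM k _; exact: ltW].
Qed.

Lemma measurable_SO_mull (g : K) :
  measurable_fun setT ((fun k => (g * k)%g) : borel K -> borel K).
Proof.
by apply: measurable_SO_mul => //; exact: measurable_cst.
Qed.

End SpecialOrthogonalHaar.

(** * The truncated power of the norm *)

Section RadialPower.
Context (R : realType) (n : nat).
Local Notation N := n.+1.
Variable mu : {sigma_finite_measure set (borel 'cV[R]_N) -> \bar R}.
Hypothesis mu_haar : is_haar (fun x y : 'cV[R]_N => x + y) mu.

Let c := fine (mu (cball 1)).

Lemma cball_volume (r : R) : 0 < r -> mu (cball r) = (r ^+ N * c)%:E.
Proof.
by move=> r0; rewrite (haar_cball mu_haar r0) EFinM /c fineK// cball_fin.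
Qed.

(** The function of x underlying [f_beta]. *)
Definition fbeta (b : R) (x : 'cV[R]_N) : R := \1_unit_ball x / enorm x `^ b.

Lemma fbetaE b x : fbeta b x = \1_(cball 1) x / enorm x `^ b.
Proof. by []. Qed.

Lemma fbeta_ge0 b x : 0 <= fbeta b x.
Proof. by rewrite /fbeta mulr_ge0 ?invr_ge0 ?powR_ge0. Qed.

Lemma measurable_fbeta b : measurable_fun setT (fbeta b : borel 'cV[R]_N -> R).
Proof.
apply: measurable_funM.
  exact: measurable_indic (measurable_cball 1).
have mp : measurable_fun setT (fun a : R => (a `^ b)^-1).
  rewrite (_ : (fun a => _) = (fun a : R => a `^ (- b))); first exact: measurable_powR.
  by apply/funext => a; rewrite powRN.
exact: (measurableT_comp mp measurable_enorm).
Qed.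

Lemma geometric_sum_le (r : R) k : 0 <= r < 1 ->
  \sum_(i < k) r ^+ i <= (1 - r)^-1.
Proof.
move=> /andP[r0 r1]; have r1' : 0 < 1 - r by rewrite subr_gt0.
rewrite -[leRHS]mul1r ler_pdivlMr// mulrC.
have -> : (1 - r) * \sum_(i < k) r ^+ i = 1 - r ^+ k.
  by rewrite -(opprB (r ^+ k)) subrX1 -mulNr opprB.
by rewrite lerBlDr lerDl exprn_ge0.
Qed.

Lemma dyadic_shell (a : R) : 0 < a < 1 ->
  exists k, (2^-1) ^+ k.+1 <= a < (2^-1) ^+ k.
Proof.
move=> /andP[a0 a1].
have ex : exists k, (2^-1) ^+ k <= a.
  exists (Num.truncn a^-1).+1; rewrite exprVn -[leRHS]invrK.
  rewrite lef_pV2 ?posrE ?exprn_gt0 ?invr_gt0//.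
  apply: (le_trans (ltW (truncnS_gt _))); rewrite -natrX ler_nat.
  exact/ltnW/ltn_expl.
case: (ex_minnP ex) => -[|k] ka kmin; first by move: ka; rewrite expr0 leNgt a1.
by exists k; rewrite ka ltNge; apply/negP => /kmin; rewrite ltnn.
Qed.

(** On the shell 2^-(k+1) <= |x| < 2^-k the function is at most 2^((k+1) g), and
    the shell has volume at most a constant times 2^(-k N), so the integral is
    dominated by a geometric series of ratio 2^(g - N). *)
Lemma fbeta_finite_integral (g : R) : 0 <= g < N%:R ->
  (\int[mu]_x (fbeta g x)%:E < +oo)%E.
Proof.
move=> /andP[g0 gN]; pose b : R := 2 `^ g; pose h : R := 2^-1.
have h0 : 0 < h by rewrite invr_gt0.
have b0 : 0 < b by exact: powR_gt0.
have hb : h `^ g = b^-1 by rewrite /h -powR_inv1// -powRrM mulrC powRrM powR_inv1 ?powR_ge0.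
pose u k (x : borel 'cV[R]_N) : \bar R := (b ^+ k.+1 * \1_(cball (h ^+ k)) x)%:E.
have u0 k x : (0 <= u k x)%E by rewrite lee_fin mulr_ge0// exprn_ge0// ltW.
have mu_ k : measurable_fun setT (u k).
  apply/measurable_EFinP; apply: measurable_funM => //.
  exact: measurable_indic (measurable_cball _).
pose r := b * h ^+ N.
have r01 : 0 <= r < 1.
  rewrite mulr_ge0 ?exprn_ge0 ?(ltW h0) ?(ltW b0)//=.
  rewrite /r /h exprVn ltr_pdivrMr ?exprn_gt0// mul1r -powR_mulrn// /b.
  rewrite -[X in _ < 2 `^ X](subrKC g) powRD ?pnatr_eq0 ?implybT//.
  rewrite ltr_pMr//; have {1}<- : 1 `^ (N%:R - g) = 1 :> R by rewrite powR1.
  by rewrite gt0_ltr_powR ?nnegrE ?subr_gt0// ltr1n.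
have uint k : (\int[mu]_x u k x = (b * c * r ^+ k)%:E)%E.
  rewrite /u; under eq_integral do rewrite EFinM.
  rewrite ge0_integralZl_EFin ?exprn_ge0 ?(ltW b0)//; last first.
    by apply/measurable_EFinP; exact: measurable_indic (measurable_cball _).
  rewrite integral_indic ?setIT//; last exact: measurable_cball.
  transitivity ((b ^+ k.+1)%:E * ((h ^+ k) ^+ N * c)%:E)%E.
    by congr (_ * _)%E; apply: cball_volume; rewrite exprn_gt0.
  rewrite -EFinM; congr EFin.
  by rewrite /r exprMn exprS -!exprM (mulnC k); ring.
apply: (@le_lt_trans _ _ (\int[mu]_x (\sum_(k <oo) u k x))%E).
  apply: ge0_le_integral => //.
  - by move=> x _; rewrite lee_fin fbeta_ge0.
  - by apply/measurable_EFinP; exact: measurable_fbeta.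
  - by apply: ge0_emeasurable_sum => // k x _ _.
  - move=> x _; rewrite fbetaE indicE.
    have [x1|] := boolP (x \in _); last by rewrite mul0r => _; exact: nneseries_ge0.
    have [->|xn0] := eqVneq (enorm x) 0.
      have [g00|gn0] := eqVneq g 0; last first.
        by rewrite powR0// invr0 mulr0; exact: nneseries_ge0.
      rewrite g00 powRr0 invr1 mulr1.
      apply: le_trans (nneseries_lim_ge 1%N (fun k _ _ => u0 k x)).
      rewrite big_nat1 /u lee_fin expr0 indicE x1 mulr1 expr1 /b g00 powRr0.
      by [].
    have xpos : 0 < enorm x < 1.
      by rewrite lt_def xn0 enorm_ge0/=; move: x1; rewrite inE.
    have [k /andP[kx xk]] := dyadic_shell xpos.
    apply: le_trans (nneseries_lim_ge k.+1 (fun k _ _ => u0 k x)).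
    rewrite big_nat_recr//=; apply: le_trans (leeDr _ _); last first.
      by apply: sume_ge0 => i _; exact: u0.
    rewrite /u lee_fin indicE mem_set// mulr1 mul1r.
    have -> : b ^+ k.+1 = ((h ^+ k.+1) `^ g)^-1.
      rewrite -(@powR_mulrn _ h) ?(ltW h0)// -powRrM mulrC powRrM hb.
      by rewrite powR_mulrn ?invr_ge0 ?(ltW b0)// exprVn invrK.
    rewrite lef_pV2 ?posrE ?powR_gt0 ?exprn_gt0//; last by case/andP: xpos.
    by rewrite ge0_ler_powR ?nnegrE ?enorm_ge0 ?exprn_ge0// ltW.
rewrite integral_nneseries//.
apply: (@le_lt_trans _ _ (b * c * (1 - r)^-1)%:E); last exact: ltry.
apply: lime_le.
  by apply: is_cvg_nneseries => k _ _; exact: integral_ge0.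
apply: nearW => k; rewrite big_mkord.
under eq_bigr do rewrite uint.
rewrite sumEFin lee_fin -mulr_sumr ler_wpM2l ?geometric_sum_le//.
by rewrite mulr_ge0 ?(ltW b0) ?fine_ge0.
Qed.

(** The maximum with 0 covers negative b, for which fbeta b <= 1. *)
Lemma fbeta_sqr_le b x :
  fbeta b x ^+ 2 <= fbeta (Num.max (b * 2) 0) x.
Proof.
rewrite !fbetaE indicE; have [x1|_] := boolP (x \in _); last first.
  by rewrite !mul0r expr0n.
rewrite !mul1r exprVn -(powR_mulrn 2 (powR_ge0 _ _)) -powRrM.
have [->|xn0] := eqVneq (enorm x) 0.
  have [b0|bn0] := eqVneq (b * 2) 0; first by rewrite b0 maxxx powRr0 invr1.
  by rewrite powR0// invr0 invr_ge0 powR_ge0.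
have x0 : 0 < enorm x by rewrite lt_def xn0 enorm_ge0.
have x1' : enorm x <= 1 by move: x1; rewrite inE => /ltW.
rewrite lef_pV2 ?posrE ?powR_gt0//; apply: ger_powR; first by rewrite x0.
by rewrite le_max lexx.
Qed.

Lemma fbeta_sqr_finite_integral b : b < N%:R / 2 ->
  (\int[mu]_x (fbeta b x ^+ 2)%:E < +oo)%E.
Proof.
move=> bN; apply: le_lt_trans (fbeta_finite_integral (g := Num.max (b * 2) 0) _).
  apply: ge0_le_integral => //.
  - by move=> x _; rewrite lee_fin sqr_ge0.
  - by apply/measurable_EFinP; apply: measurable_funX; exact: measurable_fbeta.
  - by apply/measurable_EFinP; exact: measurable_fbeta.
  - by move=> x _; rewrite lee_fin fbeta_sqr_le.
by rewrite le_max lexx orbT/= gt_max ltr0n andbT -ltr_pdivlMr.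
Qed.

Lemma integrable_fbeta b : b < N%:R / 2 ->
  mu.-integrable setT (EFin \o fbeta b).
Proof.
move=> bN; have mf := measurable_fbeta b.
have i2 : mu.-integrable setT (EFin \o (fun x => fbeta b x ^+ 2)).
  apply: ge0_integrable => [|x|]; first exact: measurable_funX.
    exact: sqr_ge0.
  exact: fbeta_sqr_finite_integral.
have i1 := integrable_indic_fin (measurable_cball 1) (cball_fin mu_haar 1).
apply: (integrable_le mf) (integrableDR i1 i2) => x.
rewrite ger0_norm ?fbeta_ge0// fbetaE indicE.
have [_|_] := boolP (x \in _); last by rewrite !mul0r expr0n addr0.
(* y <= 1 + y^2 bounds the function by an integrable one on the unit ball. *)
set y := _ / _; have := sqr_ge0 (y - 2^-1); rewrite mulr1n; nra.
Qed.

End RadialPower.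

(** * The Fourier transform of the truncated power is not in L^q *)

Section Householder.
Context (R : realType) (n : nat).
Local Notation N := n.+1.
Local Notation e1 := (@e1 R N).

Lemma dotp_e1 : dotp e1 e1 = 1.
Proof.
rewrite /dotp (bigD1 ord0)//= big1 => [|i i0]; first by rewrite !mxE mulr1 addr0.
by rewrite !mxE -val_eqE/= in i0 *; rewrite (negbTE i0) mulr0.
Qed.

(** The reflection in the hyperplane that bisects x and |x| e1. *)
Lemma householder (x : 'cV[R]_N) :
  exists P : 'M[R]_N, P^T *m P = 1%:M /\ P *m x = enorm x *: e1.
Proof.
set y := enorm x *: e1; pose v := x - y.
have yy : dotp y y = dotp x x.
  by rewrite /y dotpZl dotpZr dotp_e1 mulr1 -expr2 sqr_enorm.
have [v0|v0] := eqVneq v 0.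
  exists 1%:M; rewrite trmx1 mulmx1 mul1mx; split => //.
  by apply/eqP; rewrite -subr_eq0 -/v v0.
have vv0 : dotp v v != 0 by rewrite dotpp_eq0.
have vE : dotp v v = 2 * dotp v x.
  rewrite /v !dotpDl !dotpDr !dotpNl !dotpNr yy (dotpC y x); ring.
pose s := 2 / dotp v v; pose P : 'M[R]_N := 1%:M - s *: (v *m v^T).
have vTv : v^T *m v = (dotp v v)%:M.
  by apply/matrixP => i j; rewrite !ord1 [RHS]mxE mulr1n dotpE.
exists P; split.
  have PT : P^T = P by rewrite /P linearB/= trmx1 linearZ/= trmx_mul trmxK.
  rewrite PT /P mulmxBl mul1mx mulmxBr mulmx1 -scalemxAl -scalemxAr.
  rewrite mulmxA -(mulmxA v) vTv mul_mx_scalar -scalemxAl !scalerA opprB.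
  have -> : s * (s * dotp v v) = s + s.
    by rewrite {2}/s -mulrA mulVf// mulr1 mulr2n mulrDr mulr1.
  by rewrite scalerDl addrK subrK.
rewrite /P mulmxBl mul1mx -scalemxAl -mulmxA.
have -> : v^T *m x = (dotp v x)%:M.
  by apply/matrixP => i j; rewrite !ord1 [RHS]mxE mulr1n dotpE.
rewrite mul_mx_scalar scalerA.
have -> : s * dotp v x = 1.
  by rewrite /s mulrAC -vE divff.
by rewrite scale1r /v opprB addrCA subrr addr0.
Qed.

End Householder.

Section RadialFourier.
Context (R : realType) (n : nat).
Local Notation N := n.+1.
Local Notation V := (borel 'cV[R]_N).
Variable mu : {sigma_finite_measure set V -> \bar R}.
Hypothesis mu_haar : is_haar (fun x y : 'cV[R]_N => x + y) mu.
Variable b : R.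
Hypothesis bN : b < N%:R / 2.

Let f := @fbeta R n b.
Let c := fine (mu (cball 1)).

Let f_ge0 x : 0 <= f x. Proof. exact: fbeta_ge0. Qed.
Let mf : measurable_fun setT (f : V -> R). Proof. exact: measurable_fbeta. Qed.
Let fi : mu.-integrable setT (EFin \o f). Proof. exact: integrable_fbeta. Qed.

(** The cosine transform: f is even, so the sine part of the Fourier transform
    vanishes. *)
Definition fhat (x : 'cV[R]_N) : R := \int[mu]_y (f y * cos (dotp x y)).

Let measurable_cosdotp d (T : measurableType d) (g h : T -> V) :
  measurable_fun setT g -> measurable_fun setT h ->
  measurable_fun setT (fun t => cos (dotp (g t) (h t))).
Proof.
move=> mg mh; have mcos : measurable_fun setT (@cos R).
  by apply: continuous_measurable_fun; exact: continuous_cos.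
apply: (measurableT_comp mcos); exact: measurable_dotp.
Qed.

Let integrable_fcos x :
  mu.-integrable setT (EFin \o (fun y => f y * cos (dotp x y))).
Proof.
apply: integrable_le fi => [|y].
  by apply: measurable_funM => //; apply: measurable_cosdotp.
by rewrite normrM ger0_norm// ler_piMr// cos_max.
Qed.

Lemma fhat_bound x : `|fhat x| <= \int[mu]_y f y.
Proof.
apply: (le_trans (le_normr_Rintegral measurableT (integrable_fcos x))).
apply: le_Rintegral => //.
  by apply: eq_integrable (integrable_abse (integrable_fcos x)).
by move=> y _; rewrite normrM ger0_norm// ler_piMr// cos_max.
Qed.

Lemma measurable_fhat : measurable_fun setT (fhat : V -> R).
Proof.
(* Adding 1 to the cosine makes the integrand nonnegative, for Tonelli. *)
pose g (z : V * V) := (f z.2 * (1 + cos (dotp z.1 z.2)))%:E.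
have mg : measurable_fun setT g.
  apply/measurable_EFinP; apply: measurable_funM.
    exact: measurableT_comp.
  by apply: measurable_funD => //; exact: measurable_cosdotp.
have g0 z : (0 <= g z)%E.
  rewrite lee_fin mulr_ge0// -lerBlDl sub0r; exact: cos_geN1.
have mG := measurable_fun_fubini_tonelli_F g mg g0 (m2 := mu).
rewrite (_ : fhat = fun x => fine (fubini_F mu g x) - \int[mu]_y f y).
  apply: measurable_funB => //; apply: (measurableT_comp _ mG).
  exact: fine_measurable.
apply/funext => x; apply/eqP; rewrite eq_sym subr_eq addrC -RintegralD//.
by apply/eqP; apply: eq_Rintegral => y _; rewrite /g/= mulrDr mulr1.
Qed.

Lemma Rintegral_orthogonal (P : 'M[R]_N) (h : V -> R) :
  P^T *m P = 1%:M -> measurable_fun setT h ->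
  \int[mu]_y h (P *m y) = \int[mu]_y h y.
Proof.
move=> PP mh; apply: (Rintegral_preserving (g := mulmx P : V -> V)) => //.
  by apply: (@measurable_mulmx R N _ V P id).
by move=> A mA; exact: haar_orthogonal.
Qed.

Lemma fhat_orthogonal (P : 'M[R]_N) x : P^T *m P = 1%:M ->
  fhat (P *m x) = fhat x.
Proof.
move=> PP.
have mh : measurable_fun setT (fun y : V => f y * cos (dotp (P *m x) y)).
  by apply: measurable_funM => //; apply: measurable_cosdotp.
rewrite /fhat -(Rintegral_orthogonal PP mh); apply: eq_Rintegral => y _.
rewrite dotp_mulmx mulmxA PP mul1mx /f /fbeta !indicE enorm_orthogonal//.
congr ((nat_of_bool _)%:R / _ * _).
by apply/idP/idP; rewrite !inE /unit_ball /= enorm_orthogonal.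
Qed.

Lemma fhat_radial x : fhat x = fhat (enorm x *: @e1 R N).
Proof. by have [P [PP <-]] := householder x; rewrite fhat_orthogonal. Qed.

Let reflect (x y : V) : V := (x : 'cV[R]_N) - y.

Let measurable_reflect : measurable_fun setT (fun z => reflect z.1 z.2).
Proof.
apply: (@measurable_add R N _ (V * V)%type fst (fun z => - (z.2 : 'cV[R]_N))) => //.
rewrite (_ : (fun _ => _) = fun z => (- 1%:M : 'M[R]_N) *m z.2).
  by apply: (@measurable_mulmx R N _ (V * V)%type _ snd).
by apply/funext => z; rewrite mulNmx mul1mx.
Qed.

Let reflect_preserves x A : measurable A -> mu (reflect x @^-1` A) = mu A.
Proof.
move=> mA; pose B : set V := [set y : 'cV[R]_N | A (x + y)].
have mB : measurable B.
  by apply: (preimage_measurable _ mA); apply: measurable_add.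
have -> : reflect x @^-1` A = mulmx (- 1%:M) @^-1` B.
  by apply/seteqP; split => y; rewrite /reflect /B /= mulNmx mul1mx.
rewrite haar_orthogonal//; first exact: haar_translate.
have -> : (- 1%:M : 'M[R]_N)^T = - 1%:M.
  by apply/matrixP => i j; rewrite !mxE eq_sym.
by rewrite mulNmx mul1mx opprK.
Qed.

Let ball r : V -> R := \1_(cball r).

Let ball_ge0 r x : 0 <= ball r x. Proof. by []. Qed.

Let iball r : mu.-integrable setT (EFin \o ball r).
Proof. exact: integrable_indic_fin (measurable_cball r) (cball_fin mu_haar r). Qed.

Let mball r : measurable_fun setT (ball r).
Proof. exact: integrable_measurable (iball r). Qed.

Let int_ball r : 0 < r -> \int[mu]_x ball r x = r ^+ N * c.
Proof.
move=> r0; rewrite /Rintegral integral_indic ?setIT//; last exact: measurable_cball.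
transitivity (fine (r ^+ N * c)%:E) => //.
by congr fine; exact: cball_volume.
Qed.

Let H r := \int[mu]_x (ball r x * `|fhat x|).

Let iH r : mu.-integrable setT (EFin \o (fun x => ball r x * `|fhat x|)).
Proof.
apply: integrable_le (integrableZR (\int[mu]_y f y) (iball r)) => [|x].
  apply: measurable_funM => //; apply: measurableT_comp => //.
  exact: measurable_fhat.
by rewrite ger0_norm ?mulr_ge0// mulrC ler_wpM2r// fhat_bound.
Qed.

(** C + i S is the Fourier transform of the ball of radius r. *)
Let C r x := \int[mu]_y (ball r y * cos (dotp y x)).
Let S r x := \int[mu]_y (ball r y * sin (dotp y x)).

Let mumu := sigma_finite_product mu mu.

Let Phi r (w : V * (V * V)) : R :=
  f w.1 * (ball r w.2.1 * ball r w.2.2 * cos (dotp (reflect w.2.1 w.2.2) w.1)).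

Let ballball r : mumu.-integrable setT
  (EFin \o (fun z : V * V => ball r z.1 * ball r z.2)).
Proof. exact: integrable_prod. Qed.

Let iPhi r : (mu \x mumu)%E.-integrable setT (EFin \o Phi r).
Proof.
have := integrable_prod fi (ballball r).
apply: integrable_le => [|w].
  apply: measurable_funM; first exact: measurableT_comp.
  apply: measurable_funM.
    by apply: measurable_funM; apply: measurableT_comp => //; exact: measurableT_comp.
  apply: measurable_cosdotp => //.
  exact: (measurableT_comp measurable_reflect).
rewrite /Phi normrM [X in X * _]ger0_norm// ler_wpM2l// normrM.
by rewrite [X in X * _]ger0_norm ?mulr_ge0// ler_piMr ?mulr_ge0 ?cos_max.
Qed.

Let icos r x : mu.-integrable setT (EFin \o (fun y => ball r y * cos (dotp y x))).
Proof.
apply: integrable_le (iball r) => [|y].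
  by apply: measurable_funM => //; apply: measurable_cosdotp.
by rewrite normrM ger0_norm// ler_piMr// cos_max.
Qed.

Let isin r x : mu.-integrable setT (EFin \o (fun y => ball r y * sin (dotp y x))).
Proof.
have msin : measurable_fun setT (@sin R).
  by apply: continuous_measurable_fun; exact: continuous_sin.
apply: integrable_le (iball r) => [|y].
  apply: measurable_funM => //; apply: (measurableT_comp msin).
  by apply: measurable_dotp.
by rewrite normrM ger0_norm// ler_piMr// sin_max.
Qed.

Let int_Phi1 r x :
  \int[mumu]_z Phi r (x, z) = f x * (C r x ^+ 2 + S r x ^+ 2).
Proof.
have icc := integrable_prod (icos r x) (icos r x).
have iss := integrable_prod (isin r x) (isin r x).
rewrite !expr2 /C /S -(Rintegral_prod (icos r x) (icos r x)).
rewrite -(Rintegral_prod (isin r x) (isin r x)) -RintegralD//.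
rewrite -RintegralZ; last first.
  by apply: integrable_measurable; exact: (integrableDR icc iss).
apply: eq_Rintegral => z _; rewrite /Phi /= /reflect dotpDl dotpNl cosB.
by congr (_ * _); ring.
Qed.

Let int_Phi2 r z : \int[mu]_x Phi r (x, z) =
  ball r z.1 * ball r z.2 * fhat (reflect z.1 z.2).
Proof.
rewrite /fhat -RintegralZ; last exact: integrable_measurable (integrable_fcos _).
by apply: eq_Rintegral => x _; rewrite /Phi /=; ring.
Qed.

(** By Fubini the left side is the integral of fhat (x - y) over x and y in the
    ball of radius r; for x fixed, x - y stays in the ball of radius 2 r. *)
Let upper r : 0 < r ->
  \int[mu]_x (f x * (C r x ^+ 2 + S r x ^+ 2)) <= r ^+ N * c * H (2 * r).
Proof.
move=> r0.
have -> : \int[mu]_x (f x * (C r x ^+ 2 + S r x ^+ 2)) =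
    \int[mumu]_z (ball r z.1 * ball r z.2 * fhat (reflect z.1 z.2)).
  under eq_Rintegral do rewrite -int_Phi1.
  rewrite (RFubini (iPhi r)); apply: eq_Rintegral => z _; exact: int_Phi2.
rewrite -int_ball// /H.
rewrite -(Rintegral_skew measurable_reflect reflect_preserves (iball r) (iH (2 * r))).
apply: le_Rintegral => //.
- apply: integrable_le (integrableZR (\int[mu]_y f y) (ballball r)) => [|z].
    apply: measurable_funM.
      exact: integrable_measurable (ballball r).
    exact: (measurableT_comp measurable_fhat).
  rewrite normrM ger0_norm ?mulr_ge0// mulrC ler_wpM2r ?mulr_ge0//.
  exact: fhat_bound.
- exact: (integrable_skew measurable_reflect reflect_preserves (iball r) (iH (2 * r))).
- move=> z _; rewrite -mulrA /ball !indicE.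
  have [z1|_] := boolP (z.1 \in _); last by rewrite !mul0r.
  have [z2|_] := boolP (z.2 \in _); last by rewrite mul0r mulr0 !mulr_ge0.
  rewrite !mul1r mem_set ?mul1r ?ler_norm//.
  move: z1 z2; rewrite !inE /cball /= => z1 z2.
  by rewrite (le_lt_trans (ler_enormB _ _))// mulr2n mulrDl mul1r ltrD.
Qed.

(** For |y| < r and |x| <= 1/r the phase <y, x> is at most 1. *)
Let C_lower r x : 0 < r -> enorm x <= r^-1 -> cos 1 * (r ^+ N * c) <= C r x.
Proof.
move=> r0 xr; rewrite -int_ball// -RintegralZ; last exact: mball.
apply: le_Rintegral => //; first exact: integrableZR.
move=> y _; rewrite mulrC /ball indicE.
have [|_] := boolP (y \in _); last by rewrite !mul0r.
rewrite !mul1r inE /cball /= => yr.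
have yx1 : `|dotp y x| <= 1.
  rewrite (le_trans (ler_abs_dotp y x))//.
  by rewrite (le_trans (ler_pM (enorm_ge0 _) (enorm_ge0 _) (ltW yr) xr))// divff// gt_eqF.
have pi1 : 1 <= pi :> R by rewrite (le_trans _ (pi_ge2 R))// ler1n.
rewrite -(cos_norm (dotp y x)) leNgt ltr_cos ?in_itv/= ?ler01 ?normr_ge0 ?pi1//.
  by rewrite -leNgt.
exact: le_trans yx1 pi1.
Qed.

(** Only the shell 1/(2r) <= |x| < 1/r is used: there f >= r^b and the transform of
    the ball is at least cos 1 times its volume. The shell keeps at least half of
    the volume of the ball of radius 1/r. The origin, where f is 0 by convention,
    is avoided. *)
Let lower r : 0 <= b -> 1 <= r ->
  cos 1 ^+ 2 * (r ^+ N * c) ^+ 2 * (r `^ b * (2^-1 * (r^-1 ^+ N * c))) <=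
  \int[mu]_x (f x * (C r x ^+ 2 + S r x ^+ 2)).
Proof.
move=> b0 r1; have r0 : 0 < r by rewrite (lt_le_trans _ r1).
have rV0 : 0 < r^-1 by rewrite invr_gt0.
have h0 : 0 < 2^-1 * r^-1 by rewrite mulr_gt0 ?invr_gt0.
have V0 : 0 <= r ^+ N * c.
  by rewrite mulr_ge0 ?exprn_ge0 ?(ltW r0)// fine_ge0.
pose K := cos 1 ^+ 2 * (r ^+ N * c) ^+ 2 * r `^ b.
have K0 : 0 <= K.
  by apply: mulr_ge0 (powR_ge0 _ _); exact: mulr_ge0 (sqr_ge0 _) (sqr_ge0 _).
pose g (x : V) := K * (ball r^-1 x + - 1 * ball (2^-1 * r^-1) x).
have ig : mu.-integrable setT (EFin \o g).
  exact: integrableZR (integrableDR (iball _) (integrableZR _ (iball _))).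
have iL : mu.-integrable setT (EFin \o (fun x => f x * (C r x ^+ 2 + S r x ^+ 2))).
  have := integrable_Rsection (iPhi r).
  by apply: eq_integrable => // x _; rewrite /= -int_Phi1.
apply: (@le_trans _ _ (\int[mu]_x g x)).
  have -> : \int[mu]_x g x = K * (r^-1 ^+ N * c - (2^-1 * r^-1) ^+ N * c).
    rewrite RintegralZ; last first.
      exact: integrable_measurable (integrableDR (iball _) (integrableZR _ (iball _))).
    rewrite RintegralD//; last exact: integrableZR (iball _).
    by rewrite (RintegralZ _ _ (mball _)) !int_ball// mulN1r.
  rewrite mulrA -/K ler_wpM2l//.
  have : (2^-1 * r^-1) ^+ N * c <= 2^-1 * (r^-1 ^+ N * c).
    rewrite mulrA ler_wpM2r ?fine_ge0// exprMn ler_wpM2r ?exprn_ge0 ?(ltW rV0)//.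
    by rewrite exprS ler_piMr ?invr_ge0// exprn_ile1 ?invr_ge0// invf_le1// ler1n.
  by move=> h; lra.
apply: le_Rintegral => // x _; rewrite /g mulN1r.
have G0 : 0 <= f x * (C r x ^+ 2 + S r x ^+ 2).
  by rewrite mulr_ge0// addr_ge0 ?sqr_ge0.
have [xr|xr] := boolP (x \in cball r^-1); last first.
  apply: le_trans G0; rewrite mulr_ge0_le0// /ball !indicE (negbTE xr) sub0r.
  by rewrite oppr_le0.
have [xh|xh] := boolP (x \in cball (2^-1 * r^-1)).
  by rewrite /ball !indicE xr xh subrr mulr0.
rewrite /ball !indicE xr (negbTE xh) subr0 mulr1 /K.
have xr' : enorm x < r^-1 by move: xr; rewrite inE.
have xh' : 2^-1 * r^-1 <= enorm x.
  by rewrite leNgt; apply: contra xh => xh; rewrite inE.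
have x0 : 0 < enorm x by rewrite (lt_le_trans h0).
have fx : r `^ b <= f x.
  rewrite /f fbetaE indicE mem_set ?mul1r; last first.
    by rewrite /cball /= (lt_le_trans xr')// invf_le1.
  rewrite -powRN -[X in _ <= _ `^ X]mulN1r powRrM powR_inv1 ?enorm_ge0//.
  apply: ge0_ler_powR => //; rewrite ?nnegrE ?invr_ge0 ?(ltW r0) ?(ltW x0)//.
  by rewrite -[leLHS]invrK lef_pV2 ?posrE// ltW.
have c1 : 0 <= cos 1 :> R by rewrite ltW// cos1_gt0.
rewrite mulrC ler_pM ?powR_ge0//; first exact: mulr_ge0 (sqr_ge0 _) (sqr_ge0 _).
rewrite -exprMn (@le_trans _ _ (C r x ^+ 2))//; last by rewrite lerDl sqr_ge0.
have cV : 0 <= cos 1 * (r ^+ N * c) by rewrite mulr_ge0.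
have cC := C_lower r0 (ltW xr').
by rewrite ler_pXn2r ?nnegrE// (le_trans cV).
Qed.

(** Where |fhat| exceeds t it is at most t^(1-q) |fhat|^q. *)
Let H_le q r t : 1 < q -> 0 < r -> 0 < t ->
  mu.-integrable setT (EFin \o (fun x => `|fhat x| `^ q)) ->
  H r <= t * (r ^+ N * c) + t `^ (1 - q) * \int[mu]_x (`|fhat x| `^ q).
Proof.
move=> q1 r0 t0 iq; rewrite -int_ball// -(RintegralZ _ t (mball r)).
rewrite -(RintegralZ _ _ (integrable_measurable iq)).
rewrite -RintegralD//; [|exact: integrableZR..].
apply: le_Rintegral => //; first exact: integrableDR (integrableZR _ _) (integrableZR _ _).
move=> x _; rewrite /ball indicE; have [_|_] := boolP (x \in _); last first.
  by rewrite mul0r mulr0 add0r mulr_ge0 ?powR_ge0.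
rewrite mul1r mulr1; have [fx|fx] := leP `|fhat x| t.
  by rewrite (le_trans fx)// lerDl mulr_ge0 ?powR_ge0.
have f0 : 0 < `|fhat x| by rewrite (lt_trans t0).
apply: (@le_trans _ _ (t `^ (1 - q) * `|fhat x| `^ q)); last by rewrite lerDr ltW.
have {1}-> : `|fhat x| = `|fhat x| `^ (1 - q) * `|fhat x| `^ q.
  by rewrite -powRD ?subrK ?powRr1// (gt_eqF f0) implybT.
rewrite ler_wpM2r ?powR_ge0// -opprB !powRN lef_pV2 ?posrE ?powR_gt0//.
by rewrite ge0_ler_powR ?nnegrE ?subr_ge0 ?(ltW t0) ?(ltW f0) ?(ltW q1) ?(ltW fx).
Qed.

(** The height t = r^(-N/q) balances the two terms of [H_le], both of which become
    of size r^(N (1 - 1/q)); comparing with [lower] bounds r^b by a constant times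
    that power, for every r >= 1. *)
Lemma fhat_not_Lq q : 1 < q -> N%:R * (1 - q^-1) < b -> 0 <= b ->
  ~ mu.-integrable setT (EFin \o (fun x => `|fhat x| `^ q)).
Proof.
move=> q1 qb b0 iq; pose J := \int[mu]_x (`|fhat x| `^ q).
have J0 : 0 <= J by apply: Rintegral_ge0 => x _; exact: powR_ge0.
have c0 : 0 < c by rewrite /c fine_gt0// cball1_gt0//= -ge0_fin_numE// cball_fin.
have q0 : 0 < q by rewrite (lt_trans _ q1).
pose k := cos 1 ^+ 2 * c * (2^-1 * c) : R.
have k0 : 0 < k by rewrite !mulr_gt0 ?exprn_gt0 ?cos1_gt0 ?invr_gt0.
pose e := N%:R * (1 - q^-1).
have main r : 1 <= r -> k * r `^ b <= (2 ^+ N * c + J) * r `^ e.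
  move=> r1; have r0 : 0 < r by rewrite (lt_le_trans _ r1).
  have r2 : 0 < 2 * r by rewrite mulr_gt0.
  pose t := r `^ (- (N%:R / q)); have t0 : 0 < t by exact: powR_gt0.
  have tr : t * r ^+ N = r `^ e.
    rewrite /t -powR_mulrn ?(ltW r0)// -powRD ?(gt_eqF r0) ?implybT//.
    by congr (_ `^ _); rewrite /e mulrBr mulr1 addrC.
  have tq : t `^ (1 - q) = r `^ e.
    rewrite /t -powRrM; congr (_ `^ _); rewrite /e; field.
    by rewrite gt_eqF.
  have := le_trans (lower b0 r1) (upper r0).
  have V0 : 0 < r ^+ N * c by rewrite mulr_gt0 ?exprn_gt0.
  rewrite exprVn.
  have -> : cos 1 ^+ 2 * (r ^+ N * c) ^+ 2 * (r `^ b * (2^-1 * (r ^- N * c))) =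
    r ^+ N * c * (k * r `^ b).
    rewrite /k; field.
    by rewrite expf_neq0// gt_eqF.
  rewrite ler_pM2l// => /le_trans; apply.
  apply: (le_trans (H_le q1 r2 t0 iq)); rewrite -/J exprMn tq mulrDl.
  by rewrite le_eqVlt; apply/orP; left; apply/eqP; rewrite -tr; ring.
have eb : 0 < b - e by rewrite subr_gt0.
pose M := (2 ^+ N * c + J) / k.
have M0 : 0 <= M.
  by rewrite divr_ge0 ?(ltW k0)// addr_ge0// mulr_ge0 ?exprn_ge0// ltW.
pose r := (M + 1) `^ (b - e)^-1.
have r1 : 1 <= r.
  by rewrite /r -[leLHS](powRr0 (M + 1)) ler_powR ?lerDr ?invr_ge0 ?(ltW eb).
have := main r r1; rewrite mulrC -ler_pdivlMr// mulrAC -/M.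
have r0 : 0 < r by rewrite (lt_le_trans _ r1).
rewrite -[in X in X -> _](subrK e b) powRD ?(gt_eqF r0) ?implybT//.
rewrite (ler_pM2r (powR_gt0 e r0)).
have -> : r `^ (b - e) = M + 1.
  by rewrite /r -powRrM mulVf ?powRr1 ?addr_ge0// gt_eqF.
by rewrite leNgt ltrDl ltr01.
Qed.

Lemma measurable_fhat_radial q :
  measurable_fun setT (fun a : R => `|fhat (a *: @e1 R N)| `^ q).
Proof.
apply: (measurableT_comp (measurable_powR q)); apply: measurableT_comp => //.
apply: (measurableT_comp measurable_fhat (g := fun a : R => a *: @e1 R N : V)).
apply: measurable_fun_mx => i j.
rewrite (_ : (fun _ => _) = (fun a => a * @e1 R N i j)).
  exact: measurable_funM.
by apply/funext => a; rewrite mxE.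
Qed.

Lemma fhat_radial_diverges q : 1 < q -> N%:R * (1 - q^-1) < b -> 0 <= b ->
  (\int[lebesgue_measure]_(a in `]0%R, +oo[)
     ((`|fhat (a *: @e1 R N)| `^ q)%:E * (a ^+ n)%:E) = +oo)%E.
Proof.
move=> q1 qb b0.
pose Psi (a : R) := (`|fhat (a *: @e1 R N)| `^ q)%:E.
have mPsi : measurable_fun setT Psi.
  by apply/measurable_EFinP; exact: measurable_fhat_radial.
have Psi0 a : (0 <= Psi a)%E by rewrite lee_fin powR_ge0.
have := polar_integral mu_haar mPsi Psi0; rewrite -/c => polar.
apply/eqP; apply: contraT; rewrite -ltey => fin.
exfalso; apply: (fhat_not_Lq q1 qb b0); apply: ge0_integrable => [|x|].
- apply: (measurableT_comp (measurable_powR q)).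
  apply: measurableT_comp => //; exact: measurable_fhat.
- exact: powR_ge0.
rewrite (eq_integral (fun x : V => Psi (enorm (x : 'cV[R]_N)))); last first.
  by move=> x _; rewrite /Psi -fhat_radial.
rewrite polar.
under eq_integral => a _.
  rewrite (_ : _ * _ = (c * N%:R)%:E * (Psi a * (a ^+ n)%:E))%E; last first.
    by rewrite [RHS]muleCA; congr (_ * _)%E; rewrite -EFinM mulrA.
  over.
rewrite ge0_integralZl_EFin//.
- by rewrite lte_mul_pinfty// lee_fin mulr_ge0 ?fine_ge0.
- move=> a; rewrite /= in_itv/= andbT => a0.
  by rewrite mule_ge0// lee_fin exprn_ge0// ltW.
- apply: emeasurable_funM; first exact: measurable_funTS.
  exact/measurable_EFinP.
- by rewrite mulr_ge0 ?fine_ge0.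
Qed.

End RadialFourier.

Local Open Scope complex_scope.
Local Open Scope sesquilinear_scope.
Local Open Scope quotient_scope.
Local Notation Re := complex.Re.
Local Notation Im := complex.Im.

(** * Complex-valued integrals *)

Section ComplexIntegrable.
Context d (T : measurableType d) (R : realType).
Variable m : {measure set T -> \bar R}.
Implicit Types f g h : T -> R[i].

Definition cintegrable f : Prop :=
  m.-integrable setT (EFin \o (fun x => Re (f x))) /\
  m.-integrable setT (EFin \o (fun x => Im (f x))).

Lemma complexP (z w : R[i]) : Re z = Re w -> Im z = Im w -> z = w.
Proof. by case: z w => [a b] [c e] /= -> ->. Qed.

Lemma ReD (z w : R[i]) : Re (z + w) = Re z + Re w.
Proof. by case: z w => [a b] [c e]. Qed.

Lemma ImD (z w : R[i]) : Im (z + w) = Im z + Im w.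
Proof. by case: z w => [a b] [c e]. Qed.

Lemma ReM (z w : R[i]) : Re (z * w) = Re z * Re w - Im z * Im w.
Proof. by case: z w => [a b] [c e]. Qed.

Lemma ImM (z w : R[i]) : Im (z * w) = Re z * Im w + Im z * Re w.
Proof. by case: z w => [a b] [c e]. Qed.

Lemma normcE (z : R[i]) : Normc.normc z ^+ 2 = Re z ^+ 2 + Im z ^+ 2.
Proof. by case: z => a b; rewrite sqr_sqrtr// addr_ge0// sqr_ge0. Qed.

Lemma normc_ge0 (z : R[i]) : 0 <= Normc.normc z.
Proof. by case: z => a b; exact: sqrtr_ge0. Qed.

Lemma le_Re_normc (z : R[i]) : `|Re z| <= Normc.normc z.
Proof.
rewrite -(ler_pXn2r (ltn0Sn 1)) ?nnegrE ?normc_ge0// real_normK ?num_real//.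
by rewrite normcE lerDl sqr_ge0.
Qed.

Lemma le_Im_normc (z : R[i]) : `|Im z| <= Normc.normc z.
Proof.
rewrite -(ler_pXn2r (ltn0Sn 1)) ?nnegrE ?normc_ge0// real_normK ?num_real//.
by rewrite normcE lerDr sqr_ge0.
Qed.

Lemma cmeasurable_normc f : cmeasurable f ->
  measurable_fun setT (fun x => Normc.normc (f x)).
Proof.
move=> [mR mI]; rewrite (_ : (fun _ => _) =
  Num.sqrt \o (fun x => Re (f x) ^+ 2 + Im (f x) ^+ 2)); last first.
  by apply/funext => x /=; case: (f x).
have msqrt : measurable_fun setT (Num.sqrt : R -> R).
  by apply: continuous_measurable_fun; exact: sqrt_continuous.
by apply: measurableT_comp => //; apply: measurable_funD; apply: measurable_funX.
Qed.

Lemma cmeasurableM f g : cmeasurable f -> cmeasurable g ->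
  cmeasurable (fun x => f x * g x).
Proof.
move=> [fR fI] [gR gI]; split.
  rewrite (_ : (fun _ => _) =
    (fun x => Re (f x) * Re (g x) - Im (f x) * Im (g x))).
    by apply: measurable_funB; apply: measurable_funM.
  by apply/funext => x; rewrite ReM.
rewrite (_ : (fun _ => _) =
  (fun x => Re (f x) * Im (g x) + Im (f x) * Re (g x))).
  by apply: measurable_funD; apply: measurable_funM.
by apply/funext => x; rewrite ImM.
Qed.

Lemma cmeasurable_conj f : cmeasurable f -> cmeasurable (fun x => (f x)^*%C).
Proof.
move=> [fR fI]; split.
  by rewrite (_ : (fun _ => _) = (fun x => Re (f x)))//; apply/funext => x; case: (f x).
rewrite (_ : (fun _ => _) = (fun x => - Im (f x))).
  exact: measurable_funN.
by apply/funext => x; case: (f x).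
Qed.

Lemma cintegrable_measurable f : cintegrable f -> cmeasurable f.
Proof.
by move=> [/measurable_int fR /measurable_int fI]; split; exact/measurable_EFinP.
Qed.

Lemma le_cintegrable f (g : T -> R) : cmeasurable f ->
  (forall x, Normc.normc (f x) <= g x) -> m.-integrable setT (EFin \o g) ->
  cintegrable f.
Proof.
move=> [fR fI] fg ig; split.
  by apply: (integrable_le fR) ig => x; exact: le_trans (le_Re_normc _) (fg x).
by apply: (integrable_le fI) ig => x; exact: le_trans (le_Im_normc _) (fg x).
Qed.

Lemma cintegrable_normc f : cintegrable f ->
  m.-integrable setT (EFin \o (fun x => Normc.normc (f x))).
Proof.
move=> fi; have [fR fI] := fi.
apply: (@integrable_le _ _ _ _ _ (fun x => `|Re (f x)| + `|Im (f x)|)).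
- exact/cmeasurable_normc/cintegrable_measurable.
- move=> x; rewrite ger0_norm ?normc_ge0//.
  case: (f x) => a b /=.
  rewrite -(ler_pXn2r (ltn0Sn 1)) ?nnegrE ?addr_ge0 ?sqrtr_ge0//.
  rewrite sqr_sqrtr ?addr_ge0 ?sqr_ge0// sqrrD !real_normK ?num_real//.
  by rewrite lerD2r lerDl mulrn_wge0// mulr_ge0.
- rewrite (_ : _ \o _ = (fun x => `|(Re (f x))%:E| + `|(Im (f x))%:E|)%E)//.
  by apply: integrableD => //; apply: integrable_abse.
Qed.

Lemma cintegrableD f g : cintegrable f -> cintegrable g ->
  cintegrable (fun x => f x + g x).
Proof.
move=> [fR fI] [gR gI]; split.
  apply: eq_integrable (integrableD measurableT fR gR) => // x _.
  by rewrite /= ReD EFinD.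
apply: eq_integrable (integrableD measurableT fI gI) => // x _.
by rewrite /= ImD EFinD.
Qed.

Lemma cintegrableZ c f : cintegrable f -> cintegrable (fun x => c * f x).
Proof.
move=> fi; apply: (@le_cintegrable _ (fun x => Normc.normc c * Normc.normc (f x))).
- apply: cmeasurableM; last exact: cintegrable_measurable.
  by split; exact: measurable_cst.
- by move=> x; rewrite Normc.normcM.
- by apply: eq_integrable (integrableZl measurableT (Normc.normc c) (cintegrable_normc fi)).
Qed.

Lemma cintegrable_conj f : cintegrable f -> cintegrable (fun x => (f x)^*%C).
Proof.
move=> fi; apply: (@le_cintegrable _ (fun x => Normc.normc (f x))).
- exact/cmeasurable_conj/cintegrable_measurable.
- by move=> x; case: (f x) => a b; rewrite /= sqrrN.
- exact: cintegrable_normc.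
Qed.

Lemma cintegrable0 : cintegrable (fun=> 0).
Proof. by split; exact: integrable0. Qed.

Lemma cintegrable_sum (I : Type) (r : seq I) (F : I -> T -> R[i]) :
  (forall i, cintegrable (F i)) -> cintegrable (fun x => \sum_(i <- r) F i x).
Proof.
move=> Fi; elim: r => [|i r IH].
  rewrite (_ : (fun _ => _) = fun=> 0); first exact: cintegrable0.
  by apply/funext => x; rewrite big_nil.
rewrite (_ : (fun _ => _) = fun x => F i x + \sum_(j <- r) F j x).
  exact: cintegrableD.
by apply/funext => x; rewrite big_cons.
Qed.

Lemma cintegralD f g : cintegrable f -> cintegrable g ->
  cintegral m (fun x => f x + g x) = cintegral m f + cintegral m g.
Proof.
move=> [fR fI] [gR gI]; apply: complexP; rewrite ?ReD ?ImD /=.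
  by rewrite -RintegralD//; apply: eq_Rintegral => x _; rewrite ReD.
by rewrite -RintegralD//; apply: eq_Rintegral => x _; rewrite ImD.
Qed.

Lemma cintegral0 : cintegral m (fun=> 0) = 0.
Proof. by rewrite /cintegral /= Rintegral_cst// mul0r. Qed.

Lemma cintegral_sum (I : Type) (r : seq I) (F : I -> T -> R[i]) :
  (forall i, cintegrable (F i)) ->
  cintegral m (fun x => \sum_(i <- r) F i x) = \sum_(i <- r) cintegral m (F i).
Proof.
move=> Fi; elim: r => [|i r IH].
  rewrite big_nil -[RHS]cintegral0; congr cintegral.
  by apply/funext => x; rewrite big_nil.
rewrite big_cons -IH -cintegralD//; last exact: cintegrable_sum.
by congr cintegral; apply/funext => x; rewrite big_cons.
Qed.

Lemma cintegralZ c f : cintegrable f ->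
  cintegral m (fun x => c * f x) = c * cintegral m f.
Proof.
move=> fi; have [/measurable_int/measurable_EFinP fR
  /measurable_int/measurable_EFinP fI] := fi.
have [iR iI] := fi.
have Zi r (h : T -> R) : m.-integrable setT (EFin \o h) ->
    m.-integrable setT (EFin \o (fun x => r * h x)).
  by move=> ih; apply: eq_integrable (integrableZl measurableT r ih).
apply: complexP; rewrite ?ReM ?ImM /=.
  under eq_Rintegral do rewrite ReM.
  by rewrite RintegralB ?RintegralZ//; exact: Zi.
under eq_Rintegral do rewrite ImM.
by rewrite RintegralD ?RintegralZ//; exact: Zi.
Qed.

(** Real scalars act on the two parts separately, so this holds even for divergent
    integrals, whose value is 0. *)
Lemma cintegralZr r f : cmeasurable f ->
  cintegral m (fun x => r%:C * f x) = r%:C * cintegral m f.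
Proof.
move=> [fR fI]; apply: complexP; rewrite ?ReM ?ImM /= mul0r ?subr0 ?addr0.
  by rewrite -RintegralZ//; apply: eq_Rintegral => x _; rewrite ReM/= mul0r subr0.
by rewrite -RintegralZ//; apply: eq_Rintegral => x _; rewrite ImM/= mul0r addr0.
Qed.

Lemma cintegral_conj f : cmeasurable f ->
  cintegral m (fun x => (f x)^*%C) = (cintegral m f)^*%C.
Proof.
move=> [fR fI]; apply: complexP => /=.
  by apply: eq_Rintegral => x _; case: (f x).
rewrite -mulN1r -RintegralZ//; apply: eq_Rintegral => x _.
by rewrite mulN1r; case: (f x).
Qed.

End ComplexIntegrable.

Section ComplexFubini.
Context d1 d2 (T1 : measurableType d1) (T2 : measurableType d2) (R : realType).
Variable m1 : {sigma_finite_measure set T1 -> \bar R}.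
Variable m2 : {sigma_finite_measure set T2 -> \bar R}.
Variable F : T1 * T2 -> R[i].
Hypothesis iF : cintegrable (m1 \x m2)%E F.

Lemma cintegral12 : cintegral (m1 \x m2)%E F =
  cintegral m1 (fun x => cintegral m2 (fun y => F (x, y))).
Proof. by have [iR iI] := iF; apply: complexP; rewrite /= Rintegral12. Qed.

Lemma cintegral21 : cintegral (m1 \x m2)%E F =
  cintegral m2 (fun y => cintegral m1 (fun x => F (x, y))).
Proof. by have [iR iI] := iF; apply: complexP; rewrite /= Rintegral21. Qed.

End ComplexFubini.

Section ComplexProduct.
Context d1 d2 (T1 : measurableType d1) (T2 : measurableType d2) (R : realType).
Variable m1 : {sigma_finite_measure set T1 -> \bar R}.
Variable m2 : {sigma_finite_measure set T2 -> \bar R}.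
Variables (u : T1 -> R[i]) (v : T2 -> R[i]).
Hypotheses (iu : cintegrable m1 u) (iv : cintegrable m2 v).

Lemma cmeasurable_comp d d' (T : measurableType d) (U : measurableType d')
    (f : U -> R[i]) (g : T -> U) :
  cmeasurable f -> measurable_fun setT g -> cmeasurable (f \o g).
Proof.
by move=> [fR fI] mg; split; [exact: (measurableT_comp fR mg)
  |exact: (measurableT_comp fI mg)].
Qed.

Lemma cintegrable_prod : cintegrable (m1 \x m2)%E (fun z => u z.1 * v z.2).
Proof.
apply: le_cintegrable (integrable_prod (cintegrable_normc iu)
    (cintegrable_normc iv)) => [|z]; last by rewrite Normc.normcM.
apply: cmeasurableM.
  exact: (cmeasurable_comp (cintegrable_measurable iu) measurable_fst).
exact: (cmeasurable_comp (cintegrable_measurable iv) measurable_snd).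
Qed.

Lemma cintegral_prod :
  cintegral (m1 \x m2)%E (fun z => u z.1 * v z.2) =
  cintegral m1 u * cintegral m2 v.
Proof.
rewrite (cintegral12 cintegrable_prod) mulrC -cintegralZ//.
by congr cintegral; apply/funext => x /=; rewrite cintegralZ// mulrC.
Qed.

End ComplexProduct.

Section ComplexPreserving.
Context d (T : measurableType d) (R : realType).
Variables (m : {measure set T -> \bar R}) (g : T -> T).
Hypothesis mg : measurable_fun setT g.
Hypothesis gm : forall A, measurable A -> m (g @^-1` A) = m A.

Lemma cintegrable_preserving (f : T -> R[i]) :
  cintegrable m f -> cintegrable m (f \o g).
Proof.
by move=> [fR fI]; split; [exact: (integrable_preserving mg gm fR)
  |exact: (integrable_preserving mg gm fI)].
Qed.

Lemma cintegral_preserving (f : T -> R[i]) : cmeasurable f ->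
  cintegral m (f \o g) = cintegral m f.
Proof.
move=> [fR fI]; apply: complexP => /=.
  exact: (Rintegral_preserving mg gm fR).
exact: (Rintegral_preserving mg gm fI).
Qed.

End ComplexPreserving.

Lemma normc_expi (R : realType) (t : R) : Normc.normc (expi t) = 1.
Proof. by rewrite /Normc.normc/= cos2Dsin2 sqrtr1. Qed.

(** * The representation space for a trivial representation of M *)

Lemma trace_adjoint (R : realType) (m : nat) (A B : 'M[R[i]]_m) :
  \tr (A^t* *m B) = \sum_(p : 'I_m * 'I_m) conjc (A p.1 p.2) * B p.1 p.2.
Proof.
rewrite -(pair_bigA _ (fun i j => conjc (A i j) * B i j))/= exchange_big /=.
by apply: eq_bigr => i _; rewrite mxE; apply: eq_bigr => j _; rewrite !mxE.
Qed.

Lemma Re_trace_norm (R : realType) (m : nat) (A : 'M[R[i]]_m) :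
  Re (\tr (A^t* *m A)) = \sum_(p : 'I_m * 'I_m) Normc.normc (A p.1 p.2) ^+ 2.
Proof.
rewrite trace_adjoint (big_morph _ (@ReD R) (erefl _)); apply: eq_bigr => p _.
by rewrite normcE; case: (A _ _) => x y /=; rewrite mulNr opprK !expr2.
Qed.

Section TrivialRepresentation.
Context (R : realType) (n : nat).
Local Notation N := n.+1.
Local Notation K := (SO R N).
Local Notation V := (borel 'cV[R]_N).
Variable nu : {sigma_finite_measure set (borel K) -> \bar R}.
Hypothesis nu_haar : is_haar (fun k l : K => (k * l)%g) nu.
Variable s : irrep R N.
Hypothesis s1 : forall u, s u = 1%:M.
Local Notation d := (idim s).
Implicit Types phi psi : K -> 'M[R[i]]_d.

Let nuK := fine (nu setT).

Lemma L2K_norm2 phi : L2K nu s phi ->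
  nu.-integrable setT (EFin \o (fun k : borel K =>
    \sum_(p : 'I_d * 'I_d) Normc.normc (phi k p.1 p.2) ^+ 2)).
Proof.
move=> [mphi _ foo]; apply: ge0_integrable => [|k|].
- apply: measurable_sum => p; apply: measurable_funX.
  exact: cmeasurable_normc.
- by rewrite sumr_ge0// => p _; exact: sqr_ge0.
apply: le_lt_trans foo; rewrite le_eqVlt; apply/orP; left; apply/eqP.
by apply: eq_integral => k _; rewrite Re_trace_norm.
Qed.

Lemma L2K_pairing_entry phi psi p : L2K nu s phi -> L2K nu s psi ->
  cintegrable nu (fun k : borel K => conjc (psi k p.1 p.2) * phi k p.1 p.2).
Proof.
move=> Hphi Hpsi; have [mphi _ _] := Hphi; have [mpsi _ _] := Hpsi.
apply: le_cintegrable (integrableDR (L2K_norm2 Hphi) (L2K_norm2 Hpsi)) => [|k].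
  by apply: cmeasurableM => //; exact: cmeasurable_conj.
rewrite Normc.normcM (bigD1 p)//= [X in _ <= _ + X](bigD1 p)//=.
have -> : Normc.normc (conjc (psi k p.1 p.2)) = Normc.normc (psi k p.1 p.2).
  by case: (psi k _ _) => x y /=; rewrite sqrrN.
set y := Normc.normc (psi _ _ _); set z := Normc.normc (phi _ _ _).
set t := \sum_(_ | _) _; set t' := \sum_(_ | _) _.
have t0 : 0 <= t by apply: sumr_ge0 => i _; exact: sqr_ge0.
have t0' : 0 <= t' by apply: sumr_ge0 => i _; exact: sqr_ge0.
have y0 : 0 <= y by exact: normc_ge0.
have z0 : 0 <= z by exact: normc_ge0.
by have := sqr_ge0 (y - z); nra.
Qed.

(** Constant matrix functions are equivariant because s is trivial. *)
Lemma L2K_cst (A : 'M[R[i]]_d) : L2K nu s (fun=> A).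
Proof.
split=> [i j|u k|].
- by split; exact: measurable_cst.
- by rewrite s1 mul1mx.
- have := integrable_fin_num measurableT
    (haar_SO_integrable_cst nu_haar (Re (\tr (A^t* *m A)))).
  by rewrite fin_numElt => /andP[].
Qed.

Lemma L2K_entry phi p : L2K nu s phi ->
  cintegrable nu (fun k : borel K => phi k p.1 p.2).
Proof.
move=> Hphi; have := L2K_pairing_entry p Hphi (L2K_cst (const_mx 1)).
rewrite (_ : (fun _ => _) = (fun k : borel K => phi k p.1 p.2))//.
by apply/funext => k; rewrite mxE conjc1 mul1r.
Qed.

Lemma ipK_sum phi psi : L2K nu s phi -> L2K nu s psi ->
  ipK nu phi psi = \sum_p cintegral nu
    (fun k : borel K => conjc (psi k p.1 p.2) * phi k p.1 p.2).
Proof.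
move=> Hphi Hpsi; rewrite -cintegral_sum; last first.
  by move=> p; exact: L2K_pairing_entry.
by congr cintegral; apply/funext => k; rewrite trace_adjoint.
Qed.

Definition mean phi : 'M[R[i]]_d :=
  \matrix_(i, j) cintegral nu (fun k : borel K => phi k i j).

Lemma ipK_cstl (A : 'M[R[i]]_d) psi : L2K nu s psi ->
  ipK nu (fun=> A) psi = \tr ((mean psi)^t* *m A).
Proof.
move=> Hpsi; rewrite (ipK_sum (L2K_cst A) Hpsi) trace_adjoint.
apply: eq_bigr => p _; rewrite [in RHS]mxE.
have ip := L2K_entry p Hpsi.
rewrite -(cintegral_conj _ (cintegrable_measurable ip)) mulrC.
rewrite -cintegralZ; last exact: cintegrable_conj.
by congr cintegral; apply/funext => k; rewrite mulrC.
Qed.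

Lemma mean_cst (A : 'M[R[i]]_d) : mean (fun=> A) = nuK%:C *: A.
Proof.
apply/matrixP => i j; rewrite !mxE; apply: complexP.
  by rewrite ReM /= Rintegral_cst// mul0r subr0 mulrC.
by rewrite ImM /= Rintegral_cst// mul0r addr0 mulrC.
Qed.

Lemma ipK_conj phi psi : L2K nu s phi -> L2K nu s psi ->
  ipK nu psi phi = conjc (ipK nu phi psi).
Proof.
move=> Hphi Hpsi; rewrite !ipK_sum// (rmorph_sum (@conjc R)); apply: eq_bigr => p _.
have /cintegrable_measurable m := L2K_pairing_entry p Hphi Hpsi.
transitivity (cintegral nu (fun k : borel K =>
    conjc (conjc (psi k p.1 p.2) * phi k p.1 p.2))); last exact: cintegral_conj.
congr cintegral; apply/funext => k.
by case: (phi k _ _) (psi k _ _) => x y [z t]; apply: complexP => /=; ring.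
Qed.

Lemma L2K_measurable phi p : L2K nu s phi ->
  cmeasurable (fun k : borel K => phi k p.1 p.2).
Proof. by move=> [mphi _ _]; exact: mphi. Qed.

(** The norm of the difference is zero, so the difference vanishes almost
    everywhere. *)
Lemma mean_same_vector phi psi (c : R) : L2K nu s phi -> L2K nu s psi ->
  same_vector (@ipK R N nu s) psi (c%:C *: phi) ->
  mean psi = c%:C *: mean phi.
Proof.
move=> Hphi Hpsi /(congr1 (@Re R)).
set w : K -> 'M[R[i]]_d := psi - _ => /= w0.
pose h (k : borel K) := \sum_p Normc.normc (w k p.1 p.2) ^+ 2.
have wE k i j : w k i j = psi k i j + (- c)%:C * phi k i j.
  by rewrite /w !mxE; apply: complexP; rewrite ?ReD ?ImD; case: (phi k i j) => x y /=;
    rewrite ?mul0r; ring.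
have mw p : cmeasurable (fun k : borel K => w k p.1 p.2).
  under eq_fun do rewrite wE.
  have := cmeasurableM (f := fun=> (- c)%:C)
    (conj (measurable_cst _) (measurable_cst _)) (L2K_measurable p Hphi).
  have := L2K_measurable p Hpsi.
  move=> [a b] [a' b']; split.
    by under eq_fun do rewrite ReD; exact: measurable_funD.
  by under eq_fun do rewrite ImD; exact: measurable_funD.
have mh : measurable_fun setT h.
  by apply: measurable_sum => p; apply: measurable_funX; exact: cmeasurable_normc.
have h0 k : 0 <= h k by apply: sumr_ge0 => p _; exact: sqr_ge0.
have ih : nu.-integrable setT (EFin \o h).
  have := integrableDR (integrableZR 2 (L2K_norm2 Hpsi))
    (integrableZR (2 * c ^+ 2) (L2K_norm2 Hphi)).
  apply: integrable_le => // k; rewrite ger0_norm// !mulr_sumr -big_split /=.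
  apply: ler_sum => p _; rewrite wE !normcE.
  case: (psi k _ _) (phi k _ _) => x y [z t] /=.
  by have := sqr_ge0 (x + c * z); have := sqr_ge0 (y + c * t); nra.
have {}w0 : (\int[nu]_k `|(h k)%:E| = 0)%E.
  transitivity (\int[nu]_k (h k)%:E)%E.
    by apply: eq_integral => k _; rewrite /= ger0_norm.
  rewrite -(fineK (integrable_fin_num measurableT ih)); congr EFin.
  by rewrite -w0; apply: eq_Rintegral => k _; rewrite Re_trace_norm.
have /(ae_eq_integral_abs nu measurableT) hae : measurable_fun setT (EFin \o h).
  exact/measurable_EFinP.
have {}hae := hae.1 w0.
have int0 p : cintegral nu (fun k : borel K => w k p.1 p.2) = 0.
  have wae : {ae nu, forall k, w k p.1 p.2 = 0}.
    apply: filterS hae => k /(_ I) [] /eqP; rewrite psumr_eq0 => [|q _]; last exact: sqr_ge0.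
    by move=> /allP/(_ p (mem_index_enum _)); rewrite /= sqrf_eq0 => /eqP/Normc.eq0_normc.
  have [mR mI] := mw p.
  apply: complexP; rewrite /= /Rintegral.
    rewrite (ae_eq_integral (cst 0))//; first by rewrite integral0.
    - exact/measurable_EFinP.
    - by move: wae; apply: (@filterS _ _ (ae_filter_ringOfSetsType nu)) => k wk _; rewrite wk.
  rewrite (ae_eq_integral (cst 0))//; first by rewrite integral0.
  - exact/measurable_EFinP.
  - by move: wae; apply: (@filterS _ _ (ae_filter_ringOfSetsType nu)) => k wk _; rewrite wk.
apply/matrixP => i j; rewrite !mxE; apply/eqP; rewrite -subr_eq0; apply/eqP.
have ip := L2K_entry (i, j) Hphi; have jp := L2K_entry (i, j) Hpsi.
transitivity (cintegral nu (fun k : borel K =>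
    psi k i j + (- c)%:C * phi k i j)); last first.
  by rewrite -(int0 (i, j)); congr cintegral; apply/funext => k; rewrite wE.
rewrite cintegralD ?cintegralZ//; last exact: cintegrableZ.
by rewrite (rmorphN (real_complex R)) mulNr.
Qed.

(** An eigenvalue equation for psi = S (T phi), valid only up to null functions, can
    be tested against constants. *)
Lemma ipK_cstl_same_vector (A : 'M[R[i]]_d) phi psi (c : R) :
  L2K nu s phi -> L2K nu s psi ->
  same_vector (@ipK R N nu s) psi (c%:C *: phi) ->
  ipK nu (fun=> A) psi = c%:C * ipK nu (fun=> A) phi.
Proof.
move=> Hphi Hpsi /(mean_same_vector Hphi Hpsi) E; rewrite !ipK_cstl// E.
rewrite !trace_adjoint mulr_sumr; apply: eq_bigr => p _.
rewrite [X in conjc X]mxE mulrA (rmorphM (@conjc R)); congr (_ * _ * _).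
by apply: complexP => /=; rewrite ?oppr0.
Qed.

End TrivialRepresentation.

(** * The Fourier coefficient at the trivial representation *)

Lemma cmeasurable_sum d (T : measurableType d) (R : realType) (I : Type)
    (r : seq I) (F : I -> T -> R[i]) :
  (forall i, cmeasurable (F i)) -> cmeasurable (fun t => \sum_(i <- r) F i t).
Proof.
move=> mF; split.
  under eq_fun do rewrite (big_morph _ (@ReD R) (erefl _)).
  by apply: measurable_sum => i; have [] := mF i.
under eq_fun do rewrite (big_morph _ (@ImD R) (erefl _)).
by apply: measurable_sum => i; have [] := mF i.
Qed.

Section Phase.
Context (R : realType) (n : nat).
Local Notation N := n.+1.
Local Notation K := (SO R N).
Local Notation V := (borel 'cV[R]_N).
Variable mu : {sigma_finite_measure set V -> \bar R}.
Hypothesis mu_haar : is_haar (fun x y : 'cV[R]_N => x + y) mu.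
Variable b : R.
Hypothesis bN : b < N%:R / 2.
Variable a : R.

Definition wave (e x : 'cV[R]_N) : R[i] := (fbeta b x)%:C * expi (a * dotp e x).

Lemma cmeasurable_expi d (T : measurableType d) (h : T -> R) :
  measurable_fun setT h -> cmeasurable (fun t => expi (h t)).
Proof.
move=> mh; split => /=.
  apply: (measurableT_comp _ mh).
  by apply: continuous_measurable_fun; exact: continuous_cos.
apply: (measurableT_comp _ mh).
by apply: continuous_measurable_fun; exact: continuous_sin.
Qed.

Lemma cmeasurable_wave d (T : measurableType d) (e x : T -> V) :
  measurable_fun setT e -> measurable_fun setT x ->
  cmeasurable (fun t => wave (e t) (x t)).
Proof.
move=> me mx; apply: cmeasurableM.
  split; last exact: measurable_cst.
  exact: (measurableT_comp (measurable_fbeta b) mx).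
apply: cmeasurable_expi; apply: measurable_funM => //.
exact: measurable_dotp.
Qed.

Lemma normc_wave e x : Normc.normc (wave e x) = fbeta b x.
Proof.
rewrite Normc.normcM normc_expi mulr1 /Normc.normc/= expr0n addr0.
by rewrite sqrtr_sqr ger0_norm// fbeta_ge0.
Qed.

Lemma cintegrable_wave e : cintegrable mu (fun x : V => wave e x).
Proof.
apply: le_cintegrable (integrable_fbeta mu_haar bN) => [|x].
  by apply: cmeasurable_wave => //; exact: measurable_cst.
by rewrite normc_wave.
Qed.

Definition wave_integral : R[i] := cintegral mu (fun x : V => wave e1 x).

(** By rotation invariance the direction of the wave does not matter. *)
Lemma wave_integral_rotated (k : K) :
  cintegral mu (fun x : V => wave (((k^-1)%g : 'M[R]_N) *m e1) x) = wave_integral.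
Proof.
have E x : wave (((k^-1)%g : 'M[R]_N) *m e1) x = wave e1 ((k : 'M[R]_N) *m x).
  rewrite /wave dotp_mulmx /= trmxK; congr (_%:C * _).
  have ballE (y : 'cV[R]_N) : \1_(@unit_ball R N) y = (enorm y < 1)%R%:R :> R.
    by rewrite indicE; congr (nat_of_bool _)%:R; apply/idP/idP; rewrite inE.
  by rewrite /fbeta !ballE (enorm_orthogonal _ (SO_trmx_mul k)).
have [mR mI] := cintegrable_measurable (cintegrable_wave e1).
rewrite (_ : (fun x : V => wave _ x) = (fun x : V => wave e1 ((k : 'M[R]_N) *m x))).
  apply: complexP.
    exact: (Rintegral_orthogonal mu_haar (SO_trmx_mul k) mR).
  exact: (Rintegral_orthogonal mu_haar (SO_trmx_mul k) mI).
exact/funext.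
Qed.

Lemma Re_wave_integral : Re wave_integral = fhat mu b (a *: e1).
Proof.
apply: eq_Rintegral => x _.
by rewrite ReM /= mul0r subr0 dotpZl.
Qed.

End Phase.

Section TrivialRepresentation.
Context (R : realType) (n : nat).
Local Notation N := n.+1.
Local Notation K := (SO R N).
Local Notation V := (borel 'cV[R]_N).
Variable mu : {sigma_finite_measure set V -> \bar R}.
Hypothesis mu_haar : is_haar (fun x y : 'cV[R]_N => x + y) mu.
Variable nu : {sigma_finite_measure set (borel K) -> \bar R}.
Hypothesis nu_haar : is_haar (fun k l : K => (k * l)%g) nu.
Variable s : irrep R N.
Hypothesis s1 : forall u, s u = 1%:M.
Local Notation d := (idim s).
Implicit Types phi psi : K -> 'M[R[i]]_d.
Variable b : R.
Hypothesis bN : b < N%:R / 2.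
Variable a : R.

(** The Fourier coefficient of f_beta at (a, s), as [averaging_spec] shows. *)
Definition averaging phi : K -> 'M[R[i]]_d :=
  fun=> wave_integral mu b a *: mean nu phi.

Let translate (k : borel K) (z : V * borel K) : V * borel K :=
  (z.1, (k * z.2)%g).

Lemma measurable_inv d' (T : measurableType d') (g : T -> borel K) :
  measurable_fun setT g -> measurable_fun setT ((fun t => (g t)^-1%g) : T -> borel K).
Proof.
move=> mg; apply: measurable_fun_SO => i j.
rewrite (_ : (fun _ => _) = (fun t => (g t : 'M[R]_N) j i)).
  exact: (measurableT_comp (measurable_SO_entry j i) mg).
by apply/funext => t; rewrite /= mxE.
Qed.

Lemma measurable_direction d' (T : measurableType d') (g : T -> borel K) :
  measurable_fun setT g ->
  measurable_fun setT ((fun t => ((g t)^-1%g : 'M[R]_N) *m e1) : T -> V).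
Proof.
move=> mg; apply: measurable_fun_mx => i j.
rewrite (_ : (fun _ => _) = fun t =>
    \sum_m ((g t)^-1%g : 'M[R]_N) i m * (e1 : 'cV[R]_N) m j); last first.
  by apply/funext => t; rewrite mxE.
apply: measurable_sum => m; apply: measurable_funM; last exact: measurable_cst.
by apply: (measurableT_comp (measurable_SO_entry i m)); exact: measurable_inv.
Qed.

Let translate_preserves k B : measurable B ->
  (mu \x nu)%E (translate k @^-1` B) = (mu \x nu)%E B.
Proof.
move=> mB; apply: eq_integral => x _ /=.
rewrite -(haar_SO_translate nu_haar k (measurable_xsection x mB)).
by congr (nu _); apply/seteqP; split => l /=; rewrite /xsection /= !inE.
Qed.

Let measurable_translate :
  measurable_fun setT (fun z : borel K * (V * borel K) => translate z.1 z.2).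
Proof.
apply/measurable_fun_pairP; split => /=.
  exact: (measurableT_comp measurable_fst measurable_snd).
apply: measurable_SO_mul => //.
exact: (measurableT_comp measurable_snd measurable_snd).
Qed.

Lemma cintegral_sigma_finite_product (f : V * borel K -> R[i]) :
  cintegral (sigma_finite_product mu nu) f = cintegral (mu \x nu)%E f.
Proof. by []. Qed.

Section Kernel.
Variables phi psi : K -> 'M[R[i]]_d.
Hypotheses (Hphi : L2K nu s phi) (Hpsi : L2K nu s psi).

Let kernel p (k : borel K) (z : V * borel K) : R[i] :=
  wave b a (((k^-1)%g : 'M[R]_N) *m e1) z.1 *
  (conjc (psi k p.1 p.2) * phi (k * z.2)%g p.1 p.2).

Let cintegrable_kernel p :
  cintegrable (nu \x sigma_finite_product mu nu)%E (fun w => kernel p w.1 w.2).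
Proof.
have iphi := cintegrable_normc (L2K_entry nu_haar s1 p Hphi).
have ipsi := cintegrable_normc (L2K_entry nu_haar s1 p Hpsi).
have iv := integrable_prod (integrable_fbeta mu_haar bN) iphi.
apply: le_cintegrable (integrable_skew (m2 := sigma_finite_product mu nu)
    measurable_translate translate_preserves ipsi iv) => [|[k [x l]]].
  apply: cmeasurableM.
    apply: cmeasurable_wave; first exact: measurable_direction.
    exact: (measurableT_comp measurable_fst measurable_snd).
  apply: cmeasurableM.
    apply: cmeasurable_conj.
    exact: (cmeasurable_comp (L2K_measurable p Hpsi) measurable_fst).
  apply: (cmeasurable_comp (L2K_measurable p Hphi)).
  exact: (measurableT_comp measurable_snd measurable_translate).
rewrite /kernel Normc.normcM normc_wave Normc.normcM /= mulrCA.
suff -> : Normc.normc (conjc (psi k p.1 p.2)) = Normc.normc (psi k p.1 p.2) by [].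
by case: (psi k _ _) => y z /=; rewrite sqrrN.
Qed.

Let integral_kernel p :
  cintegral (nu \x sigma_finite_product mu nu)%E (fun w => kernel p w.1 w.2) =
  cintegral nu (fun k : borel K =>
    conjc (psi k p.1 p.2) * (wave_integral mu b a * mean nu phi p.1 p.2)).
Proof.
rewrite (cintegral12 (cintegrable_kernel p)); congr cintegral; apply/funext => k.
have iphi := L2K_entry nu_haar s1 p Hphi.
have mk := measurable_SO_mull k.
have kp (A : set (borel K)) : measurable A ->
    nu ((fun l : borel K => (k * l)%g) @^-1` A) = nu A.
  exact: haar_SO_translate.
have ik := cintegrable_preserving mk kp iphi.
rewrite cintegral_sigma_finite_product.
pose g := wave b a (((k^-1)%g : 'M[R]_N) *m e1).
pose h (l : borel K) := conjc (psi k p.1 p.2) * phi (k * l)%g p.1 p.2.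
rewrite -[LHS]/(cintegral (mu \x nu)%E (fun z => g z.1 * h z.2)).
apply: etrans (cintegral_prod (cintegrable_wave mu_haar bN a _) (cintegrableZ _ ik)) _.
rewrite wave_integral_rotated// cintegralZ// mulrCA; congr (_ * (_ * _)).
rewrite (cintegral_preserving mk kp (L2K_measurable p Hphi)).
by rewrite [RHS]mxE.
Qed.

(** The right side is an integral over (x, l) of an integral over k. Fubini puts k
    outside; then the integral over x is F(a) by rotation invariance, and the
    translation l |-> k l removes k from the integral of phi (k l). *)
Lemma averaging_spec : ipK nu (averaging phi) psi =
  cintegral (haar_motion mu nu) (fun g : V * borel K =>
    f_beta b g * ipK nu (rep_pi a g phi) psi).
Proof.
rewrite (ipK_sum (L2K_cst nu_haar s1 _) Hpsi).
under eq_bigr => p _ do rewrite /averaging mxE -integral_kernel.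
(* Fubini is applied to the sum over the entries, since for a given g the
   integrability over k is only known almost everywhere. *)
rewrite -(cintegral_sum _ cintegrable_kernel).
rewrite (cintegral21 (cintegrable_sum _ cintegrable_kernel)).
congr cintegral; apply/funext => -[x l].
rewrite /ipK /f_beta -/(fbeta b x) -cintegralZr.
  congr cintegral; apply/funext => k; rewrite trace_adjoint mulr_sumr.
  by apply: eq_bigr => p _; rewrite /kernel /wave [in RHS]mxE /=; ring.
rewrite (_ : (fun _ => _) = fun k : borel K => \sum_p
    conjc (psi k p.1 p.2) *
      (expi (a * dotp (((k^-1)%g : 'M[R]_N) *m e1) x) * phi (k * l)%g p.1 p.2)).
  apply: cmeasurable_sum => p; apply: cmeasurableM.
    exact: cmeasurable_conj (L2K_measurable p Hpsi).
  apply: cmeasurableM.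
    apply: cmeasurable_expi; apply: measurable_funM; first exact: measurable_cst.
    apply: measurable_dotp; last exact: measurable_cst.
    apply: measurable_direction; exact: measurable_id.
  apply: (cmeasurable_comp (L2K_measurable p Hphi)).
  apply: measurable_SO_mul; [exact: measurable_id|exact: measurable_cst].
by apply/funext => k; rewrite trace_adjoint; apply: eq_bigr => p _; rewrite [in LHS]mxE.
Qed.

End Kernel.
End TrivialRepresentation.

(** * A lower bound for the Schatten norm *)

Section SchattenLowerBound.
Context (R : realType) (n : nat).
Local Notation N := n.+1.
Local Notation K := (SO R N).
Local Notation V := (borel 'cV[R]_N).
Variable mu : {sigma_finite_measure set V -> \bar R}.
Hypothesis mu_haar : is_haar (fun x y : 'cV[R]_N => x + y) mu.
Variable nu : {sigma_finite_measure set (borel K) -> \bar R}.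
Hypothesis nu_haar : is_haar (fun k l : K => (k * l)%g) nu.
Variable s : irrep R N.
Hypothesis s1 : forall u, s u = 1%:M.
Local Notation d := (idim s).
Implicit Types phi psi : K -> 'M[R[i]]_d.
Variable b : R.
Hypothesis bN : b < N%:R / 2.
Variable a : R.

Let nuK := fine (nu setT).
Let A := averaging mu nu (s := s) b a.
Let w := wave_integral (n := n) mu b a.

(** The weak integral determines the operator only up to null functions, and this
    is all that is known about the operator chosen by [fourier]. *)
Let weakly_averaging (T : (K -> 'M[R[i]]_d) -> (K -> 'M[R[i]]_d)) :=
  forall phi, L2K nu s phi -> L2K nu s (T phi) /\
  forall psi, L2K nu s psi -> ipK nu (T phi) psi = ipK nu (A phi) psi.

Lemma fourier_averaging : weakly_averaging (fourier mu nu (f_beta b) a s).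
Proof.
move=> phi Hphi; rewrite /fourier; case: xgetP => [T' -> /(_ _ Hphi)[HT TE]|].
  by split => // psi Hpsi; rewrite TE// /A averaging_spec.
move=> /(_ A) []; move=> {}phi {}Hphi; split; first exact: L2K_cst.
by move=> psi Hpsi; rewrite /A averaging_spec.
Qed.

Let one : K -> 'M[R[i]]_d := fun=> 1%:M.

Let L2K1 : L2K nu s one. Proof. exact: L2K_cst. Qed.

Lemma ipK_averaging phi psi : ipK nu (A phi) (A psi) =
  (nuK * Normc.normc w ^+ 2)%:C * \tr ((mean nu psi)^t* *m mean nu phi).
Proof.
rewrite (ipK_cstl nu_haar s1) ?mean_cst -/nuK -/w; last exact: L2K_cst.
rewrite !trace_adjoint mulr_sumr; apply: eq_bigr => p _.
rewrite !mxE.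
case: (cintegral nu _) (cintegral nu _) => [x y] [z t].
by rewrite normcE; case: w => u v; apply: complexP => /=; ring.
Qed.

(** Pair S (T e) = l e with the constant 1: since S is adjoint to T, the left side is
    <T 1, T e>, in which T may be replaced by the averaging operator, and this is
    (nu(K)|F(a)|)^2 <1, e>. *)
Lemma eigenvalue_of_constants T S e (l : R) :
  weakly_averaging T ->
  adjoint_of (L2K nu s) (@ipK R N nu s) T S -> L2K nu s e ->
  same_vector (@ipK R N nu s) (S (T e)) (l%:C *: e) ->
  ipK nu one e != 0 ->
  l = (nuK * Normc.normc w) ^+ 2.
Proof.
move=> T_spec TS He Se ne0.
have [HTe TeE] := T_spec _ He; have [_ T1E] := T_spec _ L2K1.
have [_ HSTe E] := TS _ _ L2K1 HTe.
have HA phi : L2K nu s (A phi) by exact: L2K_cst.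
have E1 : ipK nu one (S (T e)) = l%:C * ipK nu one e.
  exact: ipK_cstl_same_vector.
have E2 : ipK nu one (S (T e)) = ipK nu (A one) (A e).
  apply: etrans (esym E) _; apply: etrans (T1E _ HTe) _.
  apply: etrans (ipK_conj HTe (HA one)) _.
  apply: etrans (congr1 (@conjc R) (TeE _ (HA one))) _.
  exact: esym (ipK_conj (HA e) (HA one)).
have E3 : ipK nu (A one) (A e) = ((nuK * Normc.normc w) ^+ 2)%:C * ipK nu one e.
  apply: etrans (ipK_averaging _ _) _.
  apply: etrans _ (congr1 (fun z => _ * z) (esym (ipK_cstl nu_haar s1 1%:M He))).
  have -> : mean nu one = nuK%:C *: 1%:M by exact: mean_cst.
  rewrite linearZ /= mxtraceZ mulrA -rmorphM /=.
  by congr (_%:C * _); ring.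
have := etrans (esym E1) (etrans E2 E3).
by move=> /(mulIf ne0) [].
Qed.

Lemma ipK_one_neq0 : ipK nu one one != 0.
Proof.
rewrite (ipK_cstl nu_haar s1 1%:M L2K1).
have nuK0 : 0 < nuK by exact: haar_SO_gt0.
have -> : mean nu one = nuK%:C *: 1%:M by exact: mean_cst.
rewrite trace_adjoint (eq_bigr (fun p : 'I_d * 'I_d =>
    nuK%:C * (p.1 == p.2)%:R)) => [|p _]; last first.
  rewrite !mxE; case: eqP => _; rewrite ?mulr0// !mulr1.
  by apply: complexP => /=; rewrite ?oppr0.
rewrite -mulr_sumr -(pair_bigA _ (fun i j : 'I_d => (i == j)%:R : R[i]))/=.
rewrite (eq_bigr (fun=> 1)) => [|i _]; last first.
  by rewrite (bigD1 i)//= eqxx big1 ?addr0// => j /negbTE; rewrite eq_sym => ->.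
rewrite sumr_const card_ord mulf_eq0 pnatr_eq0 (gtn_eqF (idim_gt0 s)) orbF.
by apply/eqP => -[] nuK00; move: nuK0; rewrite nuK00 ltxx.
Qed.

(** A complete orthonormal set contains a vector e with <1, e> <> 0; its eigenvalue
    alone gives the bound. *)
Lemma schatten_lower_bound (q : R) :
  (((nuK * Normc.normc w) `^ q)%:E <=
   fourier_schatten mu nu q (f_beta b) a s)%E.
Proof.
apply: le_ereal_inf_tmp => _ [S [B [lam [TS [BH B1 B0 Bc] Be ->]]]].
have nuK0 : 0 < nuK by exact: haar_SO_gt0.
have [e Bee ne0] : exists2 e, B e & ipK nu one e != 0.
  apply: contrapT => nB; move: ipK_one_neq0; rewrite -[X in ipK nu X X]subr0.
  suff -> : same_vector (@ipK R N nu s) one 0 by rewrite eqxx.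
  apply: (Bc one L2K1) => e Bee; apply: contrapT => /eqP ne; apply: nB.
  by exists e.
have lamE := eigenvalue_of_constants fourier_averaging TS (BH _ Bee) (Be _ Bee) ne0.
have x0 : 0 <= nuK * Normc.normc w by rewrite mulr_ge0 ?normc_ge0 ?ltW.
have E : (nuK * Normc.normc w) `^ q = lam e `^ (q / 2).
  by rewrite lamE -powR_mulrn// -powRrM; congr powR; field.
apply: esum_ge; exists [set e]; first by split; [exact: finite_set1|move=> _ ->].
by rewrite fsbig_set1 E.
Qed.

Lemma schatten_ge_fhat (q : R) : 0 <= q ->
  ((nuK `^ q)%:E * (`|fhat mu b (a *: e1)| `^ q)%:E <=
   fourier_schatten mu nu q (f_beta b) a s)%E.
Proof.
move=> q0; apply: le_trans (schatten_lower_bound q).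
have nuK0 : 0 <= nuK by exact/ltW/haar_SO_gt0.
rewrite -EFinM lee_fin -powRM// ge0_ler_powR ?nnegrE ?mulr_ge0 ?normc_ge0//.
by rewrite ler_wpM2l// -Re_wave_integral le_Re_normc.
Qed.

End SchattenLowerBound.

Lemma schatten_powq_ge0 (R : realType) (V : lmodType R[i]) (H : set V)
    (ip : V -> V -> R[i]) (q : R) (T : V -> V) : (0 <= schatten_powq H ip q T)%E.
Proof.
apply: le_ereal_inf_tmp => _ [S [B [lam [_ _ _ ->]]]].
by apply: esum_ge0 => e _; rewrite lee_fin powR_ge0.
Qed.

(** * The class of the trivial representation *)

Section TrivialClass.
Context (R : realType) (n : nat).

Let triv_rho (u : SOstab R n) : 'M[R[i]]_1 := 1%:M.

Fact triv_unitary u : triv_rho u \is unitarymx.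
Proof. by apply/unitarymxP; rewrite mul1mx trmx1 map_mx1. Qed.

Fact triv_continuous i j : continuous (fun u => Re (triv_rho u i j)) /\
  continuous (fun u => Im (triv_rho u i j)).
Proof. by split; exact: cst_continuous. Qed.

Fact triv_irreducible (W : {vspace 'cV[R[i]]_1}) :
  (forall u w, w \in W -> triv_rho u *m w \in W) -> W = 0%VS \/ W = fullv.
Proof.
move=> _; have [/eqP|W0] := eqVneq (\dim W) 0%N.
  by rewrite dimv_eq0 => /eqP; left.
right; apply/eqP; rewrite eqEdim subvf dimvf /dim /= mul1n.
by rewrite lt0n.
Qed.

Definition triv_irrep : irrep R n :=
  @Irrep R n 1 triv_rho isT erefl (fun _ _ => esym (mul1mx _)) triv_unitary
    triv_continuous triv_irreducible.

Definition triv_class : unitary_dual R n := \pi_(unitary_dual R n) triv_irrep.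

(** A class is represented by a chosen member, here one that is unitarily equivalent
    to the trivial representation; conjugating the identity gives the identity. *)
Lemma dual_repr_triv u : dual_repr triv_class u = 1%:M.
Proof.
have /eqmodP/asboolP[P [PP P1 Pu]] :
    \pi_(unitary_dual R n) (dual_repr triv_class) = \pi_(unitary_dual R n) triv_irrep.
  exact: reprK.
by rewrite -[LHS]mul1mx -P1 -mulmxA Pu mul1mx.
Qed.

End TrivialClass.

(** * Divergence *)

(** Monotonicity without measurability: the integral of a nonnegative function is
    the supremum of the integrals of the simple functions below it. This
    avoids the question whether the Schatten norms are measurable in a. *)
Lemma le_integral_nonmeasurable d (T : measurableType d) (R : realType)
    (m : {measure set T -> \bar R}) (D : set T) (f g : T -> \bar R) :
  (forall x, D x -> 0 <= f x)%E -> (forall x, D x -> f x <= g x)%E ->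
  (\int[m]_(x in D) f x <= \int[m]_(x in D) g x)%E.
Proof.
move=> f0 fg; rewrite integral_mkcond [leRHS]integral_mkcond.
have fg' x : (f \_ D x <= g \_ D x)%E.
  by rewrite !patchE; case: ifPn => //; rewrite inE => /fg.
have f0' x : (0 <= f \_ D x)%E.
  by rewrite patchE; case: ifPn => //; rewrite inE => /f0.
rewrite !ge0_integralTE// => [|x]; last exact: le_trans (fg' x).
apply: le_ereal_sup => _ [h hf <-]; exists h => // x.
exact: le_trans (fg' x).
Qed.

Section FBeta.
Context (R : realType) (n : nat).
Local Notation N := n.+1.
Local Notation K := (SO R N).
Local Notation V := (borel 'cV[R]_N).
Variable mu : {sigma_finite_measure set V -> \bar R}.
Hypothesis mu_haar : is_haar (fun x y : 'cV[R]_N => x + y) mu.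
Variable nu : {sigma_finite_measure set (borel K) -> \bar R}.
Hypothesis nu_haar : is_haar (fun k l : K => (k * l)%g) nu.
Variable b : R.
Hypothesis bN : b < N%:R / 2.

Lemma f_beta_square_integrable : square_integrable (haar_motion mu nu) (f_beta b).
Proof.
have mf : measurable_fun setT (fun g : V * borel K => fbeta b g.1).
  exact: (measurableT_comp (measurable_fbeta b) measurable_fst).
split; first by split; [exact: mf|exact: measurable_cst].
have sq x : 0 <= fbeta (n := n) b x ^+ 2 by exact: sqr_ge0.
have i2 : mu.-integrable setT (EFin \o (fun x : V => fbeta b x ^+ 2)).
  apply: ge0_integrable => //; first exact: measurable_funX (measurable_fbeta b).
  exact: fbeta_sqr_finite_integral.
have i1 := haar_SO_integrable_cst nu_haar 1.
have := integrable_prod i2 i1.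
move=> /(integrable_fin_num measurableT); rewrite fin_numElt => /andP[_].
apply: le_lt_trans; rewrite le_eqVlt; apply/orP; left; apply/eqP.
by apply: eq_integral => g _ /=; rewrite expr0n addr0 mulr1.
Qed.

Lemma f_beta_compactly_supported : compactly_supported (@f_beta R N b).
Proof.
pose C : set (motion R N) := [set x : 'cV[R]_N | forall i j, `|x i j| <= 1] `*` setT.
have cC : compact C by apply: compact_setX; [exact: mx_cube_compact|exact: SO_compact].
apply: (subclosed_compact _ cC); first exact: closed_closure.
have clC : closed C.
  rewrite (_ : C = fst @^-1` [set x : 'cV[R]_N | forall i j, `|x i j| <= 1]).
    apply: closed_comp; first by move=> g _; exact: cvg_fst.
    apply: compact_closed; last exact: mx_cube_compact.
    exact: norm_hausdorff.
  by apply/seteqP; split => // -[x k] [].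
rewrite closureE; apply: smallest_sub => // -[x k] /= f0; split => //= i j.
rewrite ord1; apply: le_trans (ler_coord_enorm x i) _.
move: f0; apply: contraNT; rewrite -ltNge => x1; apply/eqP.
rewrite /f_beta indicE memNset ?mul0r// /unit_ball /= => x1'.
by have := lt_trans x1 x1'; rewrite ltxx.
Qed.

End FBeta.

Theorem theorem3p4 (R : realType) (n : nat) (n_ge3 : (3 <= n)%N)
    (mu : {sigma_finite_measure set (borel 'cV[R]_n) -> \bar R})
    (nu : {sigma_finite_measure set (borel (SO R n)) -> \bar R})
    (mu_haar : is_haar (fun x y : 'cV[R]_n => x + y) mu)
    (nu_haar : is_haar (fun k l : SO R n => (k * l)%g) nu) :
  (forall beta : R, beta < n%:R / 2 ->
     square_integrable (haar_motion mu nu) (f_beta beta) /\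
     compactly_supported (@f_beta R n beta)) /\
  (forall q : R, 1 < q < 2 ->
     exists beta : R, n%:R / 3 < beta < n%:R / 2 /\
       (\int[lebesgue_measure]_(a in `]0%R, +oo[)
          ((\esum_(s in [set: unitary_dual R n])
              ((idim (dual_repr s))%:R%:E *
               fourier_schatten mu nu q (f_beta beta) a (dual_repr s))) *
           (a ^+ n.-1)%:E) = +oo)%E).
Proof.
case: n n_ge3 mu nu mu_haar nu_haar => // n _ mu nu mu_haar nu_haar.
split=> [b bN|q /andP[q1 q2]].
  split; [exact: f_beta_square_integrable|exact: f_beta_compactly_supported].
(* The open interval ]lo, n/2[ is nonempty since 1 - 1/q < 1/2; b is its midpoint. *)
pose lo := Num.max (n.+1%:R / 3) (n.+1%:R * (1 - q^-1)) : R.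
have lo2 : lo < n.+1%:R / 2.
  have n0 : 0 < n.+1%:R :> R by rewrite ltr0n.
  rewrite gt_max; apply/andP; split; first by rewrite ltr_pM2l// ltf_pV2 ?posrE// ltr_nat.
  rewrite ltr_pM2l//; have : 2^-1 < q^-1 by rewrite ltf_pV2 ?posrE//; lra.
  lra.
pose b := (lo + n.+1%:R / 2) / 2.
have [lob b2] : lo < b /\ b < n.+1%:R / 2 by rewrite /b; lra.
have [b3 bq] : n.+1%:R / 3 < b /\ n.+1%:R * (1 - q^-1) < b.
  by split; apply: le_lt_trans lob; rewrite le_max lexx ?orbT.
have b0 : 0 <= b by apply: le_trans (ltW b3); exact: divr_ge0.
exists b; split; first by rewrite b3 b2.
pose c := fine (nu setT) `^ q.
have c0 : 0 < c by rewrite powR_gt0// haar_SO_gt0.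
have := fhat_radial_diverges mu_haar b2 q1 bq b0.
set I := (\int[_]_(_ in _) _)%E => Ioo.
apply/eqP; rewrite eq_le leey /=.
have <- : (c%:E * I = +oo)%E by rewrite Ioo gt0_muley.
rewrite -ge0_integralZl//; last 3 first.
- apply: emeasurable_funM; apply/measurable_EFinP; apply: measurable_funTS.
    exact: measurable_fhat_radial.
  exact: measurable_funX (@measurable_id _ _ _).
- move=> a; rewrite /= in_itv /= andbT => a0.
  by rewrite mule_ge0 ?lee_fin ?powR_ge0 ?exprn_ge0 ?ltW.
- by rewrite lee_fin ltW.
apply: le_integral_nonmeasurable => a; rewrite /= in_itv /= andbT => a0.
  by rewrite !mule_ge0 ?lee_fin ?powR_ge0 ?exprn_ge0 ?ltW.
rewrite muleA lee_pmul2r ?lte_fin ?exprn_gt0//.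
apply: esum_ge; exists [set triv_class R n.+1]; first by split; [exact: finite_set1|].
rewrite fsbig_set1.
apply: le_trans (schatten_ge_fhat mu_haar nu_haar (@dual_repr_triv R n.+1) b2 _ _) _.
  lra.
apply: lee_pemull; first exact: schatten_powq_ge0.
by rewrite lee_fin ler1n idim_gt0.
Qed.
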